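(* For every $n, \lambda \in \mathbb{N}$, there is a complete graph $K_r$ such that every embedding of $K_r$ in $\mathbb{R}^3$ contains an oriented link with components $Q_1, \dots, Q_n$ such that for every $i \neq j$, $|\mathrm{lk}(Q_i,Q_j)| \geq \lambda$.
   Context: $K_r$ denotes the complete graph on $r$ vertices. Embeddings of graphs in $\mathbb{R}^3$ are tame (piecewise linear). A cycle is a simple closed curve within a graph. A link contained in an embedded graph is a collection of pairwise disjoint cycles of the embedded graph, which are its components; it is oriented if each component is given an orientation. $\mathrm{lk}$ denotes the linking number of two disjoint oriented simple closed curves in $\mathbb{R}^3$. *)

(* Defs.v *)
From HB Require Import structures.
From mathcomp Require Import all_boot all_order all_algebra.
From mathcomp Require Import boolp classical_sets reals.

Set Implicit Arguments.
Unset Strict Implicit.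
Unset Printing Implicit Defensive.

Import Order.TTheory GRing.Theory Num.Theory.

Local Open Scope ring_scope.

Definition complete_graph (r : nat) : rel 'I_r := [rel i j | i != j].

(* The cyclic order of the sequence [c] is the orientation of the cycle. *)
Definition oriented_cycle (T : finType) (e : rel T) (c : seq T) : Prop :=
  (2 < size c)%N /\ ucycle e c.

Definition seg_pt (R : realType) (a b : 'rV[R]_3) (s : R) : 'rV[R]_3 :=
  (1 - s) *: a + s *: b.

(* The point with parameter [s] on the [k]-th side of the polygonal line with
   successive vertices [p]. *)
Definition line_pt (R : realType) (p : seq 'rV[R]_3) (k : nat) (s : R) :=
  seg_pt p`_k p`_k.+1 s.

Definition on_line (R : realType) (p : seq 'rV[R]_3) (x : 'rV[R]_3) : Prop :=
  exists k s, [/\ (k.+1 < size p)%N, 0 <= s <= 1 & x = line_pt p k s].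

(* Injectivity of the piecewise affine parametrization of the polygonal line
   [p] that sends [k + s], for [0 <= s <= 1], to [line_pt p k s]. *)
Definition simple_line (R : realType) (p : seq 'rV[R]_3) : Prop :=
  forall (k l : nat) (s t : R),
    (k.+1 < size p)%N -> (l.+1 < size p)%N -> 0 <= s <= 1 -> 0 <= t <= 1 ->
    line_pt p k s = line_pt p l t -> k%:R + s = l%:R + t.

(* [bend i j] lists the interior vertices of the polygonal arc from [vtx i] to
   [vtx j] that represents the edge [ij]; it is meaningless if [~~ e i j]. *)
Definition arc_line (R : realType) (T : finType)
    (vtx : T -> 'rV[R]_3) (bend : T -> T -> seq 'rV[R]_3) (i j : T) :=
  vtx i :: rcons (bend i j) (vtx j).

Record pl_embedding (R : realType) (T : finType) (e : rel T) := PLEmbedding {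
  vtx : T -> 'rV[R]_3;
  bend : T -> T -> seq 'rV[R]_3;
  vtx_inj : injective vtx;
  bend_rev : forall i j, e i j -> bend j i = rev (bend i j);
  arc_simple : forall i j, e i j -> simple_line (arc_line vtx bend i j);
  arc_vtx : forall i j m, e i j -> on_line (arc_line vtx bend i j) (vtx m) ->
    m \in [set i; j];
  arc_meet : forall i j k l x, e i j -> e k l ->
    on_line (arc_line vtx bend i j) x -> on_line (arc_line vtx bend k l) x ->
    [set i; j] = [set k; l]
    \/ exists2 m, m \in [set i; j] :&: [set k; l] & x = vtx m
}.

(* The closed polygon traced by the cycle [c], as the cyclic sequence of its
   vertices. *)
Definition cycle_polygon (R : realType) (T : finType) (e : rel T)
    (f : pl_embedding R e) (c : seq T) : seq 'rV[R]_3 :=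
  flatten [seq vtx f i :: bend f i (next c i) | i <- c].

Definition sides (R : realType) (P : seq 'rV[R]_3) :
    seq ('rV[R]_3 * 'rV[R]_3) :=
  zip P (rot 1 P).

Definition triple_product (R : realType) (u v w : 'rV[R]_3) : R :=
  \det (\matrix_(i < 3) [:: u; v; w]`_i).

(* [seg_pt f.1 f.2 s] and [seg_pt g.1 g.2 t] have the same image under the
   projection along [v]. *)
Definition project_together (R : realType) (v : 'rV[R]_3)
    (f g : 'rV[R]_3 * 'rV[R]_3) (s t : R) : Prop :=
  [/\ 0 <= s <= 1, 0 <= t <= 1 &
      exists u : R, seg_pt f.1 f.2 s - seg_pt g.1 g.2 t = u *: v].

(* Projecting along [v], sides of [P] and of [Q] meet only transversally and
   away from their endpoints. Self-crossings of [P] or of [Q] do not affect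
   the linking number and are not restricted. *)
Definition regular_direction (R : realType) (P Q : seq 'rV[R]_3)
    (v : 'rV[R]_3) : Prop :=
  v != 0 /\
  forall f g s t, f \in sides P -> g \in sides Q ->
    project_together v f g s t ->
    [/\ 0 < s < 1, 0 < t < 1 &
        triple_product (f.2 - f.1) (g.2 - g.1) v != 0].

(* With the viewer in direction [v], a crossing of an over-strand directed by
   [o] and an under-strand directed by [w] has the sign of
   [triple_product o w v]. For the crossing at parameters [s], [t], put
   [seg_pt f.1 f.2 s - seg_pt g.1 g.2 t = u *: v]. If [0 < u], [f] is the
   over-strand; if [u < 0], [g] is. In both cases the sign is that of
     [triple_product (f.2 - f.1) (g.2 - g.1) (u *: v)],
   where [u *: v] may be replaced by [f.1 - g.1], because the two differ by a
   combination of [f.2 - f.1] and [g.2 - g.1]. *)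
Definition crossing_sign (R : realType) (f g : 'rV[R]_3 * 'rV[R]_3) : int :=
  sgz (triple_product (f.2 - f.1) (g.2 - g.1) (f.1 - g.1)).

Definition crossing_sum (R : realType) (P Q : seq 'rV[R]_3) (v : 'rV[R]_3) :
    int :=
  \sum_(f <- sides P) \sum_(g <- sides Q |
      `[< exists s t, project_together v f g s t >]) crossing_sign f g.

(* Half the sum of the signs of the crossings between the disjoint oriented
   closed polygons [P] and [Q] in a regular projection. Regular directions
   exist for disjoint [P] and [Q], and the value does not depend on which one
   is picked. *)
Definition linking_number (R : realType) (P Q : seq 'rV[R]_3) : rat :=
  (crossing_sum P Q (xget 0 [set v | regular_direction P Q v]%classic))%:~R / 2.

(* Main.v *)
Require Import Defs.
From mathcomp Require Import all_boot all_order all_algebra.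
From mathcomp Require Import boolp classical_sets reals.
From mathcomp Require Import ring lra zify.

(* Fix a direction [v] that is generic for all vertices and bends. The crossing
   sums [x e e'] of pairs of disjoint edges, seen along [v], determine twice the
   linking number of any two disjoint cycles by bilinearity. In a direction
   [u] transverse to [v], they satisfy, modulo 2,
     x(ij, kl) = E(i, kl) + E(j, kl) + E(k, ij) + E(l, ij) + I(ij, kl),
   where [E(p, e)] counts the points of [e] at the height of [p] that lie on one
   side of it, and [I] tells whether the heights of [i, j] and [k, l] interleave.
   Choose by Ramsey's theorem a large ordered set of vertices on which [x]
   takes, modulo [M = 2 ^ (lambda + 2)], constant values [al], [be], [ga] on
   the pairs (12, 34), (13, 24), (14, 23) of edges on 1 < 2 < 3 < 4. Summing the
   parity formula over the disjoint pairs of edges of a K5 shows that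
   [al + be + ga] is odd, summing it over two disjoint triangles shows that [al]
   is even; so [be - ga] is odd. For two zigzag cycles between [k] lower and [k]
   upper vertices, interlaced with each other, the double sum of [x] is
   [2 (k - 1) (be - ga)] modulo [M]. For [k - 1 = 2 ^ lambda] this is an odd
   multiple of [M / 2], which bounds it away from [0] although [be - ga] is
   unknown. *)

Set Implicit Arguments.
Unset Strict Implicit.
Unset Printing Implicit Defensive.

Import Order.TTheory GRing.Theory Num.Theory.

Local Open Scope ring_scope.

(** * Generic directions and coordinates *)

(** The entries of [n] are the coefficients of [q]. Hence a plane through the origin meets the
    moment curve (1, t, t^2) only at the roots of a nonzero polynomial. *)
Lemma polyX_curve (R : realType) (n : 'cV[R]_3) :
  n != 0 -> exists2 q : {poly R}, q != 0 &
    forall t, (\row_(i < 3) t ^+ i *m n) 0 0 = q.[t].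
Proof.
move=> n0; exists (\poly_(i < 3) n (inord i) 0).
  apply: contra n0 => /eqP q0; apply/eqP/matrixP => i j.
  rewrite mxE ord1 -[i in LHS]inord_val.
  by have := coef_poly 3 (fun i => n (inord i) 0) i; rewrite q0 coef0 ltn_ord.
move=> t; rewrite mxE horner_poly; apply: eq_bigr => i _.
by rewrite mxE inord_val mulrC.
Qed.

Lemma nonroot (R : realType) (q : {poly R}) : q != 0 -> exists t, q.[t] != 0.
Proof.
move=> q0; apply: contrapT => H.
pose rs : seq R := [seq i%:R | i <- iota 0 (size q)].
have urs : uniq rs.
  by rewrite map_inj_uniq ?iota_uniq // => i j /eqP; rewrite eqr_nat => /eqP.
have rrs : all (root q) rs.
  apply/allP => t _; apply/rootP; apply: contrapT => /eqP qt.
  by apply: H; exists t.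
by have := max_poly_roots q0 rrs urs; rewrite size_map size_iota ltnn.
Qed.

(** Genericity of a direction. With [S] the differences of the vertices of some polygons, it makes
    projection along [u] regular for disjoint segments between these vertices. *)
Definition off_spans (R : realType) (S : seq 'rV[R]_3) (u : 'rV[R]_3) : Prop :=
  forall d1 d2, d1 \in S -> d2 \in S -> forall x y, u <> x *: d1 + y *: d2.

(** The zero third row makes [A] singular, so a kernel vector exists even if [d1] and [d2] are
    dependent. *)
Lemma common_normal (R : realType) (d1 d2 : 'rV[R]_3) :
  exists2 n : 'cV[R]_3, n != 0 & d1 *m n = 0 /\ d2 *m n = 0.
Proof.
pose A : 'M[R]_3 := \matrix_(i < 3) [:: d1; d2; 0]`_i.
have /det0P [v v0 vA] : \det A^T == 0.
  rewrite det_tr; apply/det0P; exists (delta_mx 0 (inord 2)).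
    apply/eqP => /matrixP /(_ 0 (inord 2)) /eqP.
    by rewrite !mxE !eqxx oner_eq0.
  by rewrite -rowE rowK inordK.
have Av : A *m v^T = 0 by rewrite -[A]trmxK -trmx_mul vA trmx0.
exists v^T; first by rewrite -(inj_eq trmx_inj) trmxK trmx0.
have rowA i : row i A *m v^T = 0 by rewrite -row_mul Av row0.
have := rowA (inord 0); have := rowA (inord 1); rewrite !rowK !inordK //=.
Qed.

(* A point of the moment curve avoids finitely many planes. *)
Lemma off_spans_exists (R : realType) (S : seq 'rV[R]_3) :
  exists u, off_spans S u.
Proof.
have [q q0 Hq] : exists2 q : {poly R}, q != 0 & forall t, q.[t] != 0 ->
    off_spans S (\row_(i < 3) t ^+ i).
  suff [q q0 Hq] : exists2 q : {poly R}, q != 0 & forall t, q.[t] != 0 ->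
      forall d, d \in [seq (d1, d2) | d1 <- S, d2 <- S] -> forall x y,
      \row_(i < 3) t ^+ i <> x *: d.1 + y *: d.2.
    exists q => // t /Hq H d1 d2 h1 h2; apply: (H (d1, d2)).
    by apply/allpairsP; exists (d1, d2).
  elim: [seq (d1, d2) | d1 <- S, d2 <- S] => [|[d1 d2] s [q q0 Hq]].
    by exists 1; rewrite ?oner_neq0.
  have [n n0 [dn1 dn2]] := common_normal d1 d2.
  have [p p0 Hp] := polyX_curve n0.
  exists (p * q); first by rewrite mulf_neq0.
  move=> t; rewrite hornerM mulf_eq0 => /norP [pt qt] d.
  rewrite inE => /orP[/eqP -> /= x y e|]; last exact: Hq.
  move: pt; rewrite -Hp e mulmxDl -!scalemxAl dn1 dn2 !scaler0 addr0.
  by rewrite mxE eqxx.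
by have [t /Hq] := nonroot q0; exists (\row_(i < 3) t ^+ i).
Qed.

Lemma scale_solve (R : fieldType) (V : lmodType R) (c : R) (w e : V) :
  c != 0 -> w + c *: e = 0 -> e = - c^-1 *: w.
Proof.
move=> c0 /eqP; rewrite addr_eq0 => /eqP ->.
by rewrite scaleNr scalerN opprK scalerA mulVf // scale1r.
Qed.

Lemma triple_product_basis (R : realType) (v u e : 'rV[R]_3) :
  v != 0 -> (forall x, u <> x *: v) -> (forall x y, e <> x *: v + y *: u) ->
  triple_product v u e != 0.
Proof.
move=> v0 uv ev; apply/negP => /det0P [c c0 cM].
have {cM} : c 0 0 *: v + c 0 1 *: u + c 0 2%:R *: e = 0.
  rewrite -cM; apply/rowP => k; rewrite !mxE !big_ord_recr big_ord0 /= add0r.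
  by rewrite !mxE /=; congr (c _ _ * _ + c _ _ * _ + c _ _ * _); apply: val_inj.
have [c2|c2] := eqVneq (c 0 2%:R) 0; last first.
  by move=> /(scale_solve c2); rewrite scalerDr !scalerA => /ev.
rewrite c2 scale0r addr0.
have [c1|c1] := eqVneq (c 0 1) 0; last first.
  by move=> /(scale_solve c1); rewrite scalerA => /uv.
rewrite c1 scale0r addr0 => /eqP; rewrite scaler_eq0 (negPf v0) orbF => /eqP cc.
case/eqP: c0; apply/rowP => k; rewrite mxE.
case: k => [[|[|[|//]]] lk]; [rewrite -[RHS]cc|rewrite -[RHS]c1|rewrite -[RHS]c2];
  by congr (c _ _); apply: val_inj.
Qed.

(** The coordinates of [D] in the basis [v], [u], [e]. The last one serves below as the height, so
    that [v] and [u] are horizontal. *)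
Definition coord_in (R : realType) (v u e D : 'rV[R]_3) : 'rV[R]_3 :=
  D *m invmx (\matrix_(i < 3) [:: v; u; e]`_i).

Section Coordinates.
Variables (R : realType) (v u e : 'rV[R]_3).
Hypothesis vue : triple_product v u e != 0.
Let B : 'M[R]_3 := \matrix_(i < 3) [:: v; u; e]`_i.

Let uB : B \in unitmx. Proof. by rewrite unitmxE unitfE. Qed.

Lemma coord_inK D : D = coord_in v u e D 0 0 *: v + coord_in v u e D 0 1 *: u
  + coord_in v u e D 0 2%:R *: e.
Proof.
have {1}-> : D = coord_in v u e D *m B by rewrite mulmxKV.
move: (coord_in v u e D) => c.
apply/rowP => k; rewrite !mxE !big_ord_recr big_ord0 /= add0r !mxE /=.
by congr (c _ _ * _ + c _ _ * _ + c _ _ * _); apply: val_inj.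
Qed.

Lemma triple_product_coord D1 D2 D3 : triple_product D1 D2 D3 =
  triple_product (coord_in v u e D1) (coord_in v u e D2) (coord_in v u e D3)
  * triple_product v u e.
Proof.
rewrite /triple_product -det_mulmx; congr (\det _); apply/row_matrixP => i.
rewrite row_mul !rowK /coord_in -/B.
by case: i => [[|[|[|//]]] li] /=; rewrite mulmxKV.
Qed.

Lemma coord_in1 : [/\ coord_in v u e v = delta_mx 0 0,
  coord_in v u e u = delta_mx 0 1 & coord_in v u e e = delta_mx 0 2%:R].
Proof.
have H (i : 'I_3) : [:: v; u; e]`_i *m invmx B = delta_mx 0 i.
  have -> : [:: v; u; e]`_i = row i B by rewrite rowK.
  by rewrite -row_mul mulmxV // rowE mulmx1.
by split; rewrite /coord_in -/B; [have := H 0|have := H 1|have := H 2%:R].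
Qed.

End Coordinates.

Lemma triple_productE (R : realType) (a b c : 'rV[R]_3) :
  triple_product a b c =
    a 0 0 * (b 0 1 * c 0 2%:R - b 0 2%:R * c 0 1)
  - a 0 1 * (b 0 0 * c 0 2%:R - b 0 2%:R * c 0 0)
  + a 0 2%:R * (b 0 0 * c 0 1 - b 0 1 * c 0 0).
Proof.
rewrite /triple_product (expand_det_row _ ord0) !big_ord_recr big_ord0 /=.
rewrite /cofactor !(expand_det_row _ ord0) !big_ord_recr !big_ord0 /=.
rewrite /cofactor !det_mx11 !mxE /=.
(* Reading the entries off plain sequences identifies the various ordinals that the expansions
   produce. *)
have E (w : 'rV[R]_3) : exists s : seq R, forall i : 'I_3, w 0 i = s`_i.
  exists [:: w 0 0; w 0 1; w 0 2%:R] => -[[|[|[|//]]] li] /=;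
  by congr (w _ _); apply: val_inj.
have [a' Ea] := E a; have [b' Eb] := E b; have [c' Ec] := E c.
rewrite !Ea !Eb !Ec /= /bump /=.
ring.
Qed.

(** * Crossings of two segments *)

Definition swap_pair (T : Type) (f : T * T) := (f.2, f.1).

Definition strand_crossing (R : realType) (v : 'rV[R]_3)
    (f g : 'rV[R]_3 * 'rV[R]_3) : int :=
  if `[< exists s t, project_together v f g s t >] then crossing_sign f g else 0.

Definition transversal_pair (R : realType) (v : 'rV[R]_3)
    (f g : 'rV[R]_3 * 'rV[R]_3) : Prop :=
  forall s t, project_together v f g s t ->
    [/\ 0 < s < 1, 0 < t < 1 & triple_product (f.2 - f.1) (g.2 - g.1) v != 0].

Section Levels.
Variables (R : realType) (Z : 'rV[R]_3 -> R) (th : 'rV[R]_3 -> int).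
Implicit Types (p : 'rV[R]_3) (f g : 'rV[R]_3 * 'rV[R]_3).

(** The point at the height of [p] on the line through [g]. If [g] is horizontal, the quotient takes
    the default value of division by 0, but [passing] is then 0 and cancels the term. *)
Definition level_pt g p :=
  seg_pt g.1 g.2 ((Z p - Z g.1) / (Z g.2 - Z g.1)).

(* [1] or [-1] if the height of [p] is passed upwards or downwards along [g],
   and [0] if it is not passed, assuming that it is not that of an endpoint. *)
Definition passing p g : int := (Z p < Z g.2)%R%:Z - (Z p < Z g.1)%R%:Z.

(** In [level_l] and [level_r] alike, [th] is applied to a point of the first segment minus a point
    of the second one at the same height. *)
Definition level_l p g := passing p g * th (p - level_pt g p).
Definition level_r f p := passing p f * th (level_pt f p - p).

(* Formed from differences of a function of the endpoints of [f] and of one of the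
   endpoints of [g], so that its double sum over two closed polygons vanishes. *)
Definition level_boundary f g :=
  level_l f.2 g - level_l f.1 g + (level_r f g.2 - level_r f g.1).

Lemma passing_swap p g : passing p (swap_pair g) = - passing p g.
Proof. by rewrite /passing opprB. Qed.

Lemma level_pt_swap p g : Z g.1 != Z g.2 ->
  level_pt (swap_pair g) p = level_pt g p.
Proof.
move=> neq; rewrite /level_pt /seg_pt /= addrC; congr (_ *: _ + _ *: _);
  by field; rewrite ?subr_eq0 1?eq_sym ?neq // eq_sym neq.
Qed.

Lemma passing_in p g : Z g.1 < Z p -> Z p < Z g.2 -> passing p g = 1.
Proof. by rewrite /passing => h ->; rewrite ltNge ltW. Qed.

Lemma passing_below p g : Z p < Z g.1 -> Z p < Z g.2 -> passing p g = 0.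
Proof. by rewrite /passing => -> ->. Qed.

Lemma passing_above p g : Z g.1 < Z p -> Z g.2 < Z p -> passing p g = 0.
Proof. by rewrite /passing => h1 h2; rewrite !ltNge !ltW. Qed.

Lemma passing_eq p g : Z g.1 = Z g.2 -> passing p g = 0.
Proof. by rewrite /passing => ->; rewrite subrr. Qed.

Lemma level_l_swap p g : level_l p (swap_pair g) = - level_l p g.
Proof.
rewrite /level_l passing_swap mulNr; have [e|ne] := eqVneq (Z g.1) (Z g.2).
  by rewrite passing_eq // !mul0r.
by rewrite level_pt_swap.
Qed.

Lemma level_r_swap f p : level_r (swap_pair f) p = - level_r f p.
Proof.
rewrite /level_r passing_swap mulNr; have [e|ne] := eqVneq (Z f.1) (Z f.2).
  by rewrite passing_eq // !mul0r.
by rewrite level_pt_swap.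
Qed.

Lemma level_boundary_swapl f g :
  level_boundary (swap_pair f) g = - level_boundary f g.
Proof. by rewrite /level_boundary !level_r_swap /=; lia. Qed.

Lemma level_boundary_swapr f g :
  level_boundary f (swap_pair g) = - level_boundary f g.
Proof. by rewrite /level_boundary !level_l_swap /=; lia. Qed.

End Levels.

Section StrandSwap.
Variables (R : realType) (v : 'rV[R]_3).
Implicit Types (f g : 'rV[R]_3 * 'rV[R]_3).

Lemma seg_ptC (a b : 'rV[R]_3) s : seg_pt b a s = seg_pt a b (1 - s).
Proof. by rewrite /seg_pt subKr addrC. Qed.

Lemma seg_pt0 (a b : 'rV[R]_3) : seg_pt a b 0 = a.
Proof. by rewrite /seg_pt subr0 scale1r scale0r addr0. Qed.

Lemma seg_pt1 (a b : 'rV[R]_3) : seg_pt a b 1 = b.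
Proof. by rewrite /seg_pt subrr scale1r scale0r add0r. Qed.

Lemma project_together_swap f g s t :
  project_together v (swap_pair f) g s t <-> project_together v f g (1 - s) t.
Proof.
by rewrite /project_together /= seg_ptC; split=> -[hs ht e]; split=> //; lra.
Qed.

Lemma project_together_sym f g s t :
  project_together v f g s t <-> project_together v g f t s.
Proof.
by split=> -[hs ht [k e]]; split=> //; exists (- k); rewrite scaleNr -e opprB.
Qed.

Lemma crossing_sign_sym f g : crossing_sign g f = crossing_sign f g.
Proof.
rewrite /crossing_sign !triple_productE; congr sgz; rewrite !mxE; ring.
Qed.

Lemma crossing_sign_swap f g : crossing_sign (swap_pair f) g = - crossing_sign f g.
Proof.
rewrite /crossing_sign !triple_productE -sgzN; congr sgz; rewrite !mxE; ring.
Qed.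

Lemma strand_crossing_sym f g : strand_crossing v g f = strand_crossing v f g.
Proof.
rewrite /strand_crossing crossing_sign_sym; congr (if _ then _ else _).
by apply: asbool_equiv_eq; split=> -[s [t /project_together_sym]]; exists t, s.
Qed.

Lemma strand_crossing_swapl f g :
  strand_crossing v (swap_pair f) g = - strand_crossing v f g.
Proof.
rewrite /strand_crossing crossing_sign_swap.
rewrite (_ : `[< _ >] = `[< exists s t, project_together v f g s t >]).
  by case: ifP; rewrite ?oppr0.
apply: asbool_equiv_eq; split=> -[s [t]].
  by move/project_together_swap; exists (1 - s), t.
by move=> h; exists (1 - s), t; apply/project_together_swap; rewrite subKr.
Qed.

Lemma strand_crossing_swapr f g :
  strand_crossing v f (swap_pair g) = - strand_crossing v f g.
Proof.
by rewrite strand_crossing_sym strand_crossing_swapl strand_crossing_sym.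
Qed.

Lemma transversal_pair_swapl f g :
  transversal_pair v f g -> transversal_pair v (swap_pair f) g.
Proof.
move=> H s t /project_together_swap /H [hs ht T]; split=> //; first lra.
rewrite triple_productE in T; rewrite triple_productE -oppr_eq0.
by move: T; rewrite !mxE /=; congr (_ != _); ring.
Qed.

Lemma transversal_pair_sym f g :
  transversal_pair v f g -> transversal_pair v g f.
Proof.
move=> H s t /project_together_sym /H [hs ht T]; split=> //.
rewrite triple_productE in T; rewrite triple_productE -oppr_eq0.
by move: T; rewrite !mxE /=; congr (_ != _); ring.
Qed.

Lemma transversal_pair_swapr f g :
  transversal_pair v f g -> transversal_pair v f (swap_pair g).
Proof.
by move=> /transversal_pair_sym /transversal_pair_swapl /transversal_pair_sym.
Qed.

End StrandSwap.

(** * Common height range of two segments *)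

Section Overlap.
Variables (R : realType) (Z : 'rV[R]_3 -> R).
Hypothesis linZ : forall s a b, Z (s *: a + b) = s * Z a + Z b.
Implicit Types (f g : 'rV[R]_3 * 'rV[R]_3).

Definition gap f g s t : 'rV[R]_3 := seg_pt f.1 f.2 s - seg_pt g.1 g.2 t.

Lemma lin_gap (W : 'rV[R]_3 -> R) f g s t :
  (forall s a b, W (s *: a + b) = s * W a + W b) ->
  W (gap f g s t) = (1 - s) * W f.1 + s * W f.2 - (1 - t) * W g.1 - t * W g.2.
Proof.
move=> lin; have W0 : W 0 = 0 by have := lin (-1) 0 0; rewrite scaler0 addr0; lra.
have linS x a : W (x *: a) = x * W a by rewrite -[x *: a]addr0 lin W0 addr0.
have linN a : W (- a) = - W a by rewrite -scaleN1r linS mulN1r.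
have linD a b : W (a + b) = W a + W b by rewrite -[a]scale1r lin mul1r scale1r.
rewrite /gap /seg_pt linD linN !linD !linS; ring.
Qed.

(* Over the common range of heights of [f] and [g], the horizontal gap between them
   moves along a segment from [gap f g s0 t0] to [gap f g s1 t1]. *)
Record overlap f g s0 t0 s1 t1 : Prop := Overlap {
  ov_s : 0 <= s0 <= s1; ov_s1 : s1 <= 1;
  ov_t : 0 <= t0 <= t1; ov_t1 : t1 <= 1;
  ov_start : s0 = 0 \/ t0 = 0;
  ov_end : s1 = 1 \/ t1 = 1;
  ov_Z0 : Z (gap f g s0 t0) = 0;
  ov_Z1 : Z (gap f g s1 t1) = 0;
  ov_boundary : forall th,
    level_boundary Z th f g = th (gap f g s1 t1) - th (gap f g s0 t0);
  ov_within : forall s t, 0 <= s <= 1 -> 0 <= t <= 1 -> Z (gap f g s t) = 0 ->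
    s0 <= s <= s1 /\ t0 <= t <= t1
}.

Definition off_levels f g :=
  [/\ Z f.1 != Z g.1, Z f.1 != Z g.2, Z f.2 != Z g.1 & Z f.2 != Z g.2].

(** If the height ranges are disjoint, every [passing] is 0. Otherwise the common range goes from
    the higher of the two lower endpoints to the lower of the two upper ones, and at each of its
    ends exactly one of the two relevant terms of [level_boundary] survives. *)
Lemma overlap_or_apart f g : Z f.1 <= Z f.2 -> Z g.1 <= Z g.2 ->
  off_levels f g ->
  ((forall th, level_boundary Z th f g = 0) /\
   forall s t, 0 <= s <= 1 -> 0 <= t <= 1 -> Z (gap f g s t) <> 0)
  \/ exists s0 t0 s1 t1, overlap f g s0 t0 s1 t1.
Proof.
case: f g => [a b] [c d] /= ab cd [/= ac ad bc bd].
have gapZ s t : Z (gap (a, b) (c, d) s t) =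
   (1 - s) * Z a + s * Z b - (1 - t) * Z c - t * Z d by rewrite lin_gap.
have gapE s t : gap (a, b) (c, d) s t = seg_pt a b s - seg_pt c d t by [].
have prod (s x y : R) : 0 <= s <= 1 -> x <= y -> 0 <= s * (y - x) /\ 0 <= (1 - s) * (y - x).
  by move=> hs xy; split; apply: mulr_ge0; lra.
have [bc'|cb] := ltrP (Z b) (Z c).
  left; split=> [th|s t hs ht]; last first.
    by have := prod _ _ _ hs ab; have := prod _ _ _ ht cd; rewrite gapZ => *; lra.
  rewrite /level_boundary /level_l /level_r /=.
  rewrite [passing _ b _]passing_below 1?[passing _ a _]passing_below /=; try lra.
  rewrite [passing _ c _]passing_above 1?[passing _ d _]passing_above /=; try lra.
have [da|ad'] := ltrP (Z d) (Z a).
  left; split=> [th|s t hs ht]; last first.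
    by have := prod _ _ _ hs ab; have := prod _ _ _ ht cd; rewrite gapZ => *; lra.
  rewrite /level_boundary /level_l /level_r /=.
  rewrite [passing _ b _]passing_above 1?[passing _ a _]passing_above /=; try lra.
  rewrite [passing _ c _]passing_below 1?[passing _ d _]passing_below /=; try lra.
have {}cb : Z c < Z b by rewrite lt_neqAle eq_sym bc.
have {}ad' : Z a < Z d by rewrite lt_neqAle ad.
right.
(* Bottom of the common range: [a] or [c], whichever is higher, and the point of the other segment
   at that height. *)
have [s0 [t0 [s00 t00 st0 [Z0 lb0 in0]]]] : exists s0 t0,
  [/\ 0 <= s0 <= 1, 0 <= t0 <= 1, s0 = 0 \/ t0 = 0 &
   [/\ Z (gap (a, b) (c, d) s0 t0) = 0,
    forall th, level_l Z th a (c, d) + level_r Z th (a, b) c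
               = th (gap (a, b) (c, d) s0 t0) &
    forall s t, 0 <= s <= 1 -> 0 <= t <= 1 -> Z (gap (a, b) (c, d) s t) = 0 ->
    s0 <= s /\ t0 <= t]].
  have [ca|ac'] := ltrP (Z c) (Z a).
    have cd0 : 0 < Z d - Z c by lra.
    have [t te] : exists t, t * (Z d - Z c) = Z a - Z c.
      by exists ((Z a - Z c) / (Z d - Z c)); rewrite divfK // gt_eqF.
    exists 0, t; rewrite gapZ; split; [lra| |by left|split].
    - by apply/andP; split; rewrite -(ler_pM2r cd0); lra.
    - by lra.
    - move=> th; rewrite /level_l /level_r passing_in // ?passing_below //=.
      rewrite mul0r mul1r addr0 gapE seg_pt0 /level_pt /= -te.
      by rewrite mulfK // gt_eqF.
    - move=> s t' hs ht'; rewrite gapZ => e; split; first lra.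
      by rewrite -(ler_pM2r cd0); have := prod _ _ _ hs ab; lra.
  have {}ac' : Z a < Z c by rewrite lt_neqAle ac.
  have ab0 : 0 < Z b - Z a by lra.
  have [s se] : exists s, s * (Z b - Z a) = Z c - Z a.
    by exists ((Z c - Z a) / (Z b - Z a)); rewrite divfK // gt_eqF.
  exists s, 0; rewrite gapZ; split; [ |lra|by right|split].
  - by apply/andP; split; rewrite -(ler_pM2r ab0); lra.
  - by lra.
  - move=> th; rewrite /level_l /level_r passing_below ?passing_in //=.
    rewrite mul0r mul1r add0r gapE seg_pt0 /level_pt /= -se.
    by rewrite mulfK // gt_eqF.
  - move=> s' t' hs ht'; rewrite gapZ => e; split; last lra.
    by rewrite -(ler_pM2r ab0); have := prod _ _ _ ht' cd; lra.
(* Top of the common range: [b] or [d], whichever is lower, and the point of the other segment at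
   that height. *)
have [s1 [t1 [s11 t11 st1 [Z1 lb1 in1]]]] : exists s1 t1,
  [/\ 0 <= s1 <= 1, 0 <= t1 <= 1, s1 = 1 \/ t1 = 1 &
   [/\ Z (gap (a, b) (c, d) s1 t1) = 0,
    forall th, level_l Z th b (c, d) + level_r Z th (a, b) d
               = th (gap (a, b) (c, d) s1 t1) &
    forall s t, 0 <= s <= 1 -> 0 <= t <= 1 -> Z (gap (a, b) (c, d) s t) = 0 ->
    s <= s1 /\ t <= t1]].
  have [bd'|db] := ltrP (Z b) (Z d).
    have cd0 : 0 < Z d - Z c by lra.
    have [t te] : exists t, t * (Z d - Z c) = Z b - Z c.
      by exists ((Z b - Z c) / (Z d - Z c)); rewrite divfK // gt_eqF.
    exists 1, t; rewrite gapZ; split; [lra| |by left|split].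
    - by apply/andP; split; rewrite -(ler_pM2r cd0); lra.
    - by lra.
    - move=> th; rewrite /level_l /level_r passing_in ?passing_above //=.
      rewrite mul0r mul1r addr0 gapE seg_pt1 /level_pt /= -te.
      by rewrite mulfK // gt_eqF.
    - move=> s t' hs ht'; rewrite gapZ => e; split; first lra.
      by rewrite -(ler_pM2r cd0); have := prod _ _ _ hs ab; lra.
  have {}db : Z d < Z b by rewrite lt_neqAle eq_sym bd.
  have ab0 : 0 < Z b - Z a by lra.
  have [s se] : exists s, s * (Z b - Z a) = Z d - Z a.
    by exists ((Z d - Z a) / (Z b - Z a)); rewrite divfK // gt_eqF.
  exists s, 1; rewrite gapZ; split; [ |lra|by right|split].
  - by apply/andP; split; rewrite -(ler_pM2r ab0); lra.
  - by lra.
  - move=> th; rewrite /level_l /level_r passing_above ?passing_in //=.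
    rewrite mul0r mul1r add0r gapE seg_pt1 /level_pt /= -se.
    by rewrite mulfK // gt_eqF.
  - move=> s' t' hs ht'; rewrite gapZ => e; split; last lra.
    by rewrite -(ler_pM2r ab0); have := prod _ _ _ ht' cd; lra.
have [? ?] := in1 _ _ s00 t00 Z0.
exists s0, t0, s1, t1; split=> //; try lra.
- move=> th; rewrite -(lb1 th) -(lb0 th) /level_boundary /=.
  by rewrite addrACA opprD.
- move=> s t hs ht e; have [? ?] := in0 _ _ hs ht e.
  by have [? ?] := in1 _ _ hs ht e; split; apply/andP.
Qed.

End Overlap.

(** * Crossings read off from the motion of the gap *)

Section LocalCrossing.
Variables (R : realType) (X Y Z : 'rV[R]_3 -> R) (D : R).
Hypothesis linX : forall s a b, X (s *: a + b) = s * X a + X b.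
Hypothesis linY : forall s a b, Y (s *: a + b) = s * Y a + Y b.
Hypothesis linZ : forall s a b, Z (s *: a + b) = s * Z a + Z b.
Hypothesis tripleE : forall a b c, triple_product a b c =
  (X a * (Y b * Z c - Z b * Y c) - Y a * (X b * Z c - Z b * X c)
   + Z a * (X b * Y c - Y b * X c)) * D.
Implicit Types (f g : 'rV[R]_3 * 'rV[R]_3).

(** The segments are not both horizontal, so the parameters with a horizontal gap form a segment, on
    which [W] is affine. It vanishes there exactly when its end values, both nonzero, have opposite
    signs. *)
Lemma overlap_cross (W : 'rV[R]_3 -> R) f g s0 t0 s1 t1 :
  (forall s a b, W (s *: a + b) = s * W a + W b) ->
  Z f.1 <= Z f.2 -> Z g.1 <= Z g.2 -> Z f.1 != Z g.1 ->
  overlap Z f g s0 t0 s1 t1 ->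
  W (gap f g s0 t0) != 0 -> W (gap f g s1 t1) != 0 ->
  (exists s t, [/\ 0 <= s <= 1, 0 <= t <= 1, W (gap f g s t) = 0
                 & Z (gap f g s t) = 0])
  <-> W (gap f g s0 t0) * W (gap f g s1 t1) < 0.
Proof.
move=> linW leZf leZg neZ [hs hs1 ht ht1 _ _ Z0 Z1 _ within] nW0 nW1.
set W0 := W _ in nW0 *; set W1 := W _ in nW1 *.
have gW := lin_gap f g _ _ linW; have gZ := lin_gap f g _ _ linZ.
split=> [[s [t [hs' ht' Ws Zs]]]|W01]; last first.
  have W01n : W0 - W1 != 0.
    by apply/eqP => e; move: W01; rewrite (_ : W1 = W0) ?ltNge -?expr2 ?sqr_ge0; lra.
  (* The affine function going from [W0] to [W1] vanishes at the parameter [x]. *)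
  have [x xe] : exists x, x * (W0 - W1) = W0.
    by exists (W0 / (W0 - W1)); rewrite divfK.
  have hx : 0 <= x <= 1.
    have [W00|W00] := ltrP 0 W0.
      have W10 : W1 < 0 by move: W01; rewrite pmulr_rlt0.
      have P : 0 < W0 - W1 by lra.
      by apply/andP; split; rewrite -(ler_pM2r P); lra.
    have {}W00 : W0 < 0 by rewrite lt_neqAle nW0.
    have W10 : 0 < W1 by move: W01; rewrite nmulr_rlt0.
    have P : W0 - W1 < 0 by lra.
    by apply/andP; split; rewrite -(ler_nM2r P); lra.
  have P1 : 0 <= x * (s1 - s0) by apply: mulr_ge0; lra.
  have P2 : 0 <= (1 - x) * (s1 - s0) by apply: mulr_ge0; lra.
  have P3 : 0 <= x * (t1 - t0) by apply: mulr_ge0; lra.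
  have P4 : 0 <= (1 - x) * (t1 - t0) by apply: mulr_ge0; lra.
  exists (s0 + x * (s1 - s0)), (t0 + x * (t1 - t0)).
  split; [lra|lra| |].
    transitivity ((1 - x) * W0 + x * W1); last lra.
    by rewrite /W0 /W1 !gW; ring.
  transitivity ((1 - x) * Z (gap f g s0 t0) + x * Z (gap f g s1 t1)).
    by rewrite !gZ; ring.
  by rewrite Z0 Z1 !mulr0 addr0.
have [hss htt] := within _ _ hs' ht' Zs.
suff : W0 * W1 <= 0 by rewrite lt_neqAle mulf_neq0.
(* Up to the factor [M], [K] is the slope of [W] along the horizontal gaps, measured in the
   parameter of [f]. The variant [key'] measures it in that of [g] and serves when [g] is
   horizontal. *)
have key (K M : R) : 0 < M -> W0 * M = - (s - s0) * K -> W1 * M = (s1 - s) * K ->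
    W0 * W1 <= 0.
  move=> M0 e0 e1; have M2 : 0 < M ^+ 2 by rewrite exprn_gt0.
  rewrite -(ler_pM2r M2) mul0r.
  have -> : W0 * W1 * M ^+ 2 = (W0 * M) * (W1 * M) by ring.
  rewrite e0 e1.
  have -> : - (s - s0) * K * ((s1 - s) * K) = - ((s - s0) * (s1 - s) * K ^+ 2) by ring.
  rewrite oppr_le0; apply: mulr_ge0; last exact: sqr_ge0.
  by apply: mulr_ge0; lra.
have key' (K M : R) : 0 < M -> W0 * M = - (t - t0) * K -> W1 * M = (t1 - t) * K ->
    W0 * W1 <= 0.
  move=> M0 e0 e1; have M2 : 0 < M ^+ 2 by rewrite exprn_gt0.
  rewrite -(ler_pM2r M2) mul0r.
  have -> : W0 * W1 * M ^+ 2 = (W0 * M) * (W1 * M) by ring.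
  rewrite e0 e1.
  have -> : - (t - t0) * K * ((t1 - t) * K) = - ((t - t0) * (t1 - t) * K ^+ 2) by ring.
  rewrite oppr_le0; apply: mulr_ge0; last exact: sqr_ge0.
  by apply: mulr_ge0; lra.
rewrite gZ in Zs; rewrite gZ in Z0; rewrite gZ in Z1; rewrite gW in Ws.
set a := W f.1 in Ws; set b := W f.2 in Ws; set c := W g.1 in Ws.
set d := W g.2 in Ws.
have dW0 : W0 = - (s - s0) * (b - a) + (t - t0) * (d - c).
  by rewrite /W0 gW -/a -/b -/c -/d; lra.
have dW1 : W1 = (s1 - s) * (b - a) - (t1 - t) * (d - c).
  by rewrite /W1 gW -/a -/b -/c -/d; lra.
have dZ0 : (s - s0) * (Z f.2 - Z f.1) = (t - t0) * (Z g.2 - Z g.1) by lra.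
have dZ1 : (s1 - s) * (Z f.2 - Z f.1) = (t1 - t) * (Z g.2 - Z g.1) by lra.
have [Zg|Zg] := ltrP (Z g.1) (Z g.2).
  apply: (key ((b - a) * (Z g.2 - Z g.1) - (Z f.2 - Z f.1) * (d - c))
              (Z g.2 - Z g.1)); first lra.
    by rewrite dW0 mulrDl -[X in _ + X]mulrA [(d - c) * _]mulrC mulrA -dZ0; ring.
  by rewrite dW1 mulrBl -[X in _ - X]mulrA [(d - c) * _]mulrC mulrA -dZ1; ring.
have Zge : Z g.2 = Z g.1 by lra.
have Zf : 0 < Z f.2 - Z f.1.
  rewrite lt_neqAle subr_ge0 leZf andbT eq_sym subr_eq0; apply: contra neZ => /eqP e.
  by apply/eqP; move: Z0; rewrite e Zge; lra.
rewrite Zge subrr !mulr0 in dZ0 dZ1.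
have es : s = s0.
  by move/eqP: dZ0; rewrite mulf_eq0 (gt_eqF Zf) orbF subr_eq0 => /eqP.
have es1 : s1 = s.
  by move/eqP: dZ1; rewrite mulf_eq0 (gt_eqF Zf) orbF subr_eq0 => /eqP.
apply: (key' (- (d - c)) 1); first lra.
  by rewrite dW0 es; ring.
by rewrite dW1 es1; ring.
Qed.

(** The crossing sign is the sense in which the horizontal gap turns about the origin on its way
    through the common range, corrected by the orientation [D] of the coordinates. *)
Lemma overlap_sign f g s0 t0 s1 t1 :
  Z f.1 <= Z f.2 -> Z g.1 <= Z g.2 -> Z f.1 != Z g.1 ->
  overlap Z f g s0 t0 s1 t1 ->
  (X (gap f g s0 t0) != X (gap f g s1 t1))
    || (Y (gap f g s0 t0) != Y (gap f g s1 t1)) ->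
  crossing_sign f g = sgz D * sgz (X (gap f g s0 t0) * Y (gap f g s1 t1)
    - X (gap f g s1 t1) * Y (gap f g s0 t0)).
Proof.
move=> leZf leZg neZ [hs hs1 ht ht1 _ _ Z0 Z1 _ _] neq.
have linB (W : 'rV[R]_3 -> R) : (forall s a b, W (s *: a + b) = s * W a + W b) ->
    forall a b, W (a - b) = W a - W b.
  by move=> lin a b; rewrite addrC -scaleN1r lin mulN1r addrC.
rewrite /crossing_sign tripleE sgzM mulrC.
congr (_ * _); move: neq Z0 Z1.
rewrite !(lin_gap _ _ _ _ linX) !(lin_gap _ _ _ _ linY) !(lin_gap _ _ _ _ linZ).
rewrite !(linB X) // !(linB Y) // !(linB Z) //.
case: f g leZf leZg neZ => [a b] [c d] /=.
move: (X a) (Y a) (Z a) (X b) (Y b) (Z b) (X c) (Y c) (Z c) (X d) (Y d) (Z d).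
move=> xa ya za xb yb zb xc yc zc xd yd zd leZf leZg neZ neq Z0 Z1.
set det := (X in sgz X = _); set tgt := (X in _ = sgz X).
have step : (s1 - s0) * (zb - za) = (t1 - t0) * (zd - zc) by lra.
have zce : zc = (1 - s0) * za + s0 * zb - t0 * (zd - zc) by lra.
(* Either segment may be horizontal, hence two proportionalities: [E1] has positive factors if [g]
   ascends, and [E2] if [g] is horizontal. *)
have E1 : (s1 - s0) * det = (zd - zc) * tgt.
  rewrite /det /tgt.
  pose zB := zd - zc; pose zA := zb - za.
  have -> : za - zc = - (s0 * zA) + t0 * zB by rewrite /zA /zB; lra.
  rewrite -/zA -/zB in step *.
  transitivity ((s1 - s0) * zA *
      ((xd - xc) * ((1 - s0) * ya + s0 * yb - (1 - t0) * yc - t0 * yd)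
      - (yd - yc) * ((1 - s0) * xa + s0 * xb - (1 - t0) * xc - t0 * xd))
    - (s1 - s0) * zB * ((xb - xa) * ((1 - s0) * ya + s0 * yb - (1 - t0) * yc - t0 * yd)
      - (yb - ya) * ((1 - s0) * xa + s0 * xb - (1 - t0) * xc - t0 * xd))).
    ring.
  rewrite step; ring.
have E2 : (t1 - t0) * det = (zb - za) * tgt.
  rewrite /det /tgt.
  pose zB := zd - zc; pose zA := zb - za.
  have -> : za - zc = - (s0 * zA) + t0 * zB by rewrite /zA /zB; lra.
  rewrite -/zA -/zB in step *.
  transitivity ((t1 - t0) * zA *
      ((xd - xc) * ((1 - s0) * ya + s0 * yb - (1 - t0) * yc - t0 * yd)
      - (yd - yc) * ((1 - s0) * xa + s0 * xb - (1 - t0) * xc - t0 * xd))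
    - (t1 - t0) * zB * ((xb - xa) * ((1 - s0) * ya + s0 * yb - (1 - t0) * yc - t0 * yd)
      - (yb - ya) * ((1 - s0) * xa + s0 * xb - (1 - t0) * xc - t0 * xd))).
    ring.
  rewrite -step; ring.
have pos_sgz (p q x y : R) : 0 < p -> 0 < q -> p * x = q * y -> sgz x = sgz y.
  move=> p0 q0 e; have := congr1 (@sgz R) e.
  by rewrite !sgzM (gtr0_sgz p0) (gtr0_sgz q0) !mul1r.
have st : s0 = s1 -> t0 = t1 -> False by move=> es et; move: neq; rewrite es et !eqxx.
have [zg|zg] := ltrP zc zd.
  apply: (pos_sgz _ _ _ _ _ _ E1); last lra.
  rewrite subr_gt0 lt_neqAle; case/andP: hs => _ ->; rewrite andbT.
  apply/eqP => es; apply: (st es); apply/eqP.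
  have zg' : zd - zc != 0 by apply: lt0r_neq0; lra.
  move/eqP: step; rewrite es subrr mul0r eq_sym mulf_eq0 (negPf zg') orbF.
  by rewrite subr_eq0 eq_sym.
have ez : zd = zc by lra.
have zf : 0 < zb - za.
  rewrite lt_neqAle subr_ge0 leZf andbT eq_sym subr_eq0; apply: contra neZ => /eqP e.
  by apply/eqP; move: Z0; rewrite e ez; lra.
apply: (pos_sgz _ _ _ _ _ _ E2) => //.
rewrite subr_gt0 lt_neqAle; case/andP: ht => _ ->; rewrite andbT.
apply/eqP => et; apply: st => //; apply/eqP.
move/eqP: step; rewrite et subrr mul0r mulf_eq0 (gt_eqF zf) orbF.
by rewrite subr_eq0 eq_sym.
Qed.

End LocalCrossing.

Definition disjoint_segments (R : realType) (f g : 'rV[R]_3 * 'rV[R]_3) :=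
  forall s t, 0 <= s <= 1 -> 0 <= t <= 1 ->
    seg_pt f.1 f.2 s != seg_pt g.1 g.2 t.

(** The triple product factors as [k] times that of the regularity condition; disjointness makes [k]
    nonzero. *)
Lemma crossing_sign_neq0 (R : realType) (v : 'rV[R]_3) f g s t :
  transversal_pair v f g -> disjoint_segments f g ->
  project_together v f g s t -> crossing_sign f g != 0.
Proof.
move=> tr dj pt; have [_ _ T] := tr _ _ pt; case: pt => hs ht [k e].
have k0 : k != 0.
  apply: contra (dj s t hs ht) => /eqP k0.
  by rewrite -subr_eq0 e k0 scale0r.
rewrite /crossing_sign sgz_eq0.
suff -> : triple_product (f.2 - f.1) (g.2 - g.1) (f.1 - g.1)
    = k * triple_product (f.2 - f.1) (g.2 - g.1) v by rewrite mulf_neq0.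
have C i : f.1 0 i - g.1 0 i
    = k * v 0 i - s * (f.2 0 i - f.1 0 i) + t * (g.2 0 i - g.1 0 i).
  by have /rowP/(_ i) := e; rewrite !mxE => <-; ring.
rewrite !triple_productE !mxE !C; ring.
Qed.

(* Turning counterclockwise about the origin, one enters the quadrants [0 < x * y]
   across the axis [y = 0] and leaves them across the axis [x = 0]. *)
Lemma quadrant_change (R : realType) (x0 y0 x1 y1 : R) :
  x0 != 0 -> y0 != 0 -> x1 != 0 -> y1 != 0 ->
  let s := sgz (x0 * y1 - x1 * y0) in
  (if y0 * y1 < 0 then s else 0) - (if x0 * x1 < 0 then s else 0)
  = (0 < x1 * y1)%R%:Z - (0 < x0 * y0)%R%:Z.
Proof.
move=> x00 y00 x10 y10 s; rewrite {}/s.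
have gt0E (x y : R) : x != 0 -> y != 0 -> (0 < x * y) = ~~ ((x < 0) (+) (y < 0)).
  move=> nx ny; rewrite ltNge le_eqVlt mulf_eq0 (negPf nx) (negPf ny) /=.
  by rewrite mulr_lt0 nx ny.
rewrite !mulr_lt0 !gt0E // x00 y00 x10 y10 /=.
have pos (x : R) : x != 0 -> ~~ (x < 0) -> 0 < x.
  by move=> nx; rewrite -leNgt lt_neqAle eq_sym nx.
have sg (x y : R) : 0 < x -> y < 0 -> sgz (x - y) = 1.
  by move=> hx hy; rewrite gtr0_sgz //; lra.
have sg' (x y : R) : x < 0 -> 0 < y -> sgz (x - y) = -1.
  by move=> hx hy; rewrite ltr0_sgz //; lra.
have [x0n|/(pos _ x00) x0p] := boolP (x0 < 0);
have [y0n|/(pos _ y00) y0p] := boolP (y0 < 0);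
have [x1n|/(pos _ x10) x1p] := boolP (x1 < 0);
have [y1n|/(pos _ y10) y1p] := boolP (y1 < 0); rewrite /= ?subrr ?subr0 ?sub0r //;
first [rewrite sg; first by [] | rewrite sg'; first by []];
first [exact: mulr_gt0 | by rewrite nmulr_rgt0 | by rewrite pmulr_rlt0
      | by rewrite nmulr_rlt0].
Qed.

Section Local.
Variables (R : realType) (X Y Z : 'rV[R]_3 -> R) (D : R) (v u : 'rV[R]_3).
Hypothesis linX : forall s a b, X (s *: a + b) = s * X a + X b.
Hypothesis linY : forall s a b, Y (s *: a + b) = s * Y a + Y b.
Hypothesis linZ : forall s a b, Z (s *: a + b) = s * Z a + Z b.
Hypothesis tripleE : forall a b c, triple_product a b c =
  (X a * (Y b * Z c - Z b * Y c) - Y a * (X b * Z c - Z b * X c)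
   + Z a * (X b * Y c - Y b * X c)) * D.
Hypothesis vP : forall w, (exists k, w = k *: v) <-> Y w = 0 /\ Z w = 0.
Hypothesis uP : forall w, (exists k, w = k *: u) <-> X w = 0 /\ Z w = 0.
Implicit Types (f g : 'rV[R]_3 * 'rV[R]_3).

(** Seen along [w], the segments cross where the horizontal gap meets the axis [W = 0]. At both ends
    of the common range one of the segments is at an endpoint, so transversality keeps the gap off
    this axis there. *)
Lemma overlap_strand (W : 'rV[R]_3 -> R) w f g s0 t0 s1 t1 :
  (forall s a b, W (s *: a + b) = s * W a + W b) ->
  (forall x, (exists k, x = k *: w) <-> W x = 0 /\ Z x = 0) ->
  Z f.1 <= Z f.2 -> Z g.1 <= Z g.2 -> off_levels Z f g ->
  transversal_pair w f g -> overlap Z f g s0 t0 s1 t1 ->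
  [/\ W (gap f g s0 t0) != 0, W (gap f g s1 t1) != 0,
     strand_crossing w f g = if W (gap f g s0 t0) * W (gap f g s1 t1) < 0
                             then crossing_sign f g else 0 &
     disjoint_segments f g -> W (gap f g s0 t0) * W (gap f g s1 t1) < 0 ->
     crossing_sign f g != 0].
Proof.
move=> linW wP lef leg [neZ _ _ _] tr ov.
have ptP s t : project_together w f g s t <->
    [/\ 0 <= s <= 1, 0 <= t <= 1, W (gap f g s t) = 0 & Z (gap f g s t) = 0].
  by split=> [[hs ht /wP[W0 Z0]]|[hs ht W0 Z0]]; split=> //; apply/wP.
case: (ov) => [hs hs1 ht ht1 st0 st1 Z0 Z1 _ _].
have nW0 : W (gap f g s0 t0) != 0.
  apply/eqP => W0; have [|h1 h2 _] := tr s0 t0.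
    by apply/ptP; split=> //; lra.
  by case: st0 => e; lra.
have nW1 : W (gap f g s1 t1) != 0.
  apply/eqP => W0; have [|h1 h2 _] := tr s1 t1.
    by apply/ptP; split=> //; lra.
  by case: st1 => e; lra.
have crP := overlap_cross linZ linW lef leg neZ ov nW0 nW1.
split=> //; last first.
  by move=> dj /crP [s [t /ptP /(crossing_sign_neq0 tr dj)]].
rewrite /strand_crossing; congr (if _ then _ else _).
apply/asboolP/idP => [[s [t /ptP h]]|/crP [s [t /ptP h]]].
  by apply/crP; exists s, t.
by exists s, t.
Qed.

Lemma apart_strand (W : 'rV[R]_3 -> R) w f g :
  (forall x, (exists k, x = k *: w) <-> W x = 0 /\ Z x = 0) ->
  (forall s t, 0 <= s <= 1 -> 0 <= t <= 1 -> Z (gap f g s t) <> 0) ->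
  strand_crossing w f g = 0.
Proof.
move=> wP ap; rewrite /strand_crossing; case: asboolP => // -[s [t [hs ht /wP[_]]]].
by move/(ap _ _ hs ht).
Qed.

(** A crossing seen along [v] is a passage of the gap across the axis [Y = 0], and one seen along
    [u] is a passage across [X = 0]. By [quadrant_change] their difference is the change of the
    indicator of the quadrants [0 < X * Y], which is a boundary. *)
Lemma ascending_direction_change f g :
  Z f.1 <= Z f.2 -> Z g.1 <= Z g.2 -> off_levels Z f g ->
  transversal_pair v f g -> transversal_pair u f g ->
  strand_crossing v f g - strand_crossing u f g
  = sgz D * level_boundary Z (fun w => (0 < X w * Y w)%R%:Z) f g.
Proof.
move=> lef leg offl trv tru.
have [[b0 ap]|[s0 [t0 [s1 [t1 ov]]]]] := overlap_or_apart linZ lef leg offl.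
  by rewrite b0 mulr0 (apart_strand vP) // (apart_strand uP).
have [Y0 Y1 -> _] := overlap_strand linY vP lef leg offl trv ov.
have [X0 X1 -> _] := overlap_strand linX uP lef leg offl tru ov.
rewrite (ov_boundary ov) -quadrant_change // mulrBr.
have sE := overlap_sign linX linY linZ tripleE lef leg _ ov.
have neq (x y : R) : x * y < 0 -> x != y.
  by apply: contraTneq => ->; rewrite -leNgt -expr2 sqr_ge0.
congr (_ - _).
  by case: ifP => [/neq h|_]; rewrite ?mulr0 // sE ?h ?orbT //; case: offl.
by case: ifP => [/neq h|_]; rewrite ?mulr0 // sE ?h ?orbT //; case: offl.
Qed.

(** A crossing contributes 1 or -1, and it occurs exactly when the indicator of [0 < Y] changes
    along the common range; modulo 2 the two agree. *)
Lemma ascending_parity f g :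
  Z f.1 <= Z f.2 -> Z g.1 <= Z g.2 -> off_levels Z f g ->
  transversal_pair v f g -> disjoint_segments f g -> exists k,
  strand_crossing v f g = level_boundary Z (fun w => (0 < Y w)%R%:Z) f g + 2 * k.
Proof.
move=> lef leg offl trv dj.
have [[b0 ap]|[s0 [t0 [s1 [t1 ov]]]]] := overlap_or_apart linZ lef leg offl.
  by exists 0; rewrite b0 (apart_strand vP).
have [Y0 Y1 -> /(_ dj)] := overlap_strand linY vP lef leg offl trv ov.
rewrite (ov_boundary ov) mulr_lt0 Y0 Y1 /=.
have ltE (x : R) : x != 0 -> (x < 0) = ~~ (0 < x).
  by move=> nx; rewrite -leNgt le_eqVlt (negPf nx).
rewrite !ltE //.
have c01 : crossing_sign f g != 0 -> crossing_sign f g = 1 \/ crossing_sign f g = -1.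
  by rewrite /crossing_sign; case: sgzP => // _ _; [left|right].
case: (0 < Y (gap f g s0 t0)); case: (0 < Y (gap f g s1 t1)) => /= h;
  try (by exists 0); case: (c01 (h erefl)) => ->.
- by exists 1.
- by exists 0.
- by exists 0.
- by exists (-1).
Qed.

(** Reversing a segment changes the sign of both sides, so both segments may be taken to ascend. *)
Lemma direction_change f g :
  off_levels Z f g -> transversal_pair v f g -> transversal_pair u f g ->
  strand_crossing v f g - strand_crossing u f g
  = sgz D * level_boundary Z (fun w => (0 < X w * Y w)%R%:Z) f g.
Proof.
move=> offl trv tru.
wlog lef : f g offl trv tru / Z f.1 <= Z f.2 => [H|].
  have [le|/ltW le] := lerP (Z f.1) (Z f.2); first exact: H.
  have := H (swap_pair f) g _ (transversal_pair_swapl trv)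
    (transversal_pair_swapl tru) le.
  rewrite !strand_crossing_swapl level_boundary_swapl mulrN => e.
  by apply: oppr_inj; rewrite -e; [rewrite opprB opprK addrC|case: offl].
have [leg|/ltW leg] := lerP (Z g.1) (Z g.2); first exact: ascending_direction_change.
have := @ascending_direction_change f (swap_pair g) lef leg _
  (transversal_pair_swapr trv) (transversal_pair_swapr tru).
rewrite !strand_crossing_swapr level_boundary_swapr mulrN => H.
by apply: oppr_inj; rewrite -H; [rewrite opprB opprK addrC|case: offl].
Qed.

Lemma crossing_parity f g :
  off_levels Z f g -> transversal_pair v f g -> disjoint_segments f g -> exists k,
  strand_crossing v f g = level_boundary Z (fun w => (0 < Y w)%R%:Z) f g + 2 * k.
Proof.
move=> offl tr dj.
wlog lef : f g offl tr dj / Z f.1 <= Z f.2 => [H|].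
  have [le|/ltW le] := lerP (Z f.1) (Z f.2); first exact: H.
  have [| |k] := H (swap_pair f) g _ (transversal_pair_swapl tr) _ le.
  - by case: offl.
  - by move=> s t hs ht; rewrite seg_ptC; apply: dj; lra.
  rewrite strand_crossing_swapl level_boundary_swapl => e.
  by exists (- k); lia.
have [leg|/ltW leg] := lerP (Z g.1) (Z g.2); first exact: ascending_parity.
have [| |k] := @ascending_parity f (swap_pair g) lef leg _ (transversal_pair_swapr tr).
- by case: offl.
- by move=> s t hs ht; rewrite [seg_pt (swap_pair g).1 _ _]seg_ptC; apply: dj; lra.
rewrite strand_crossing_swapr level_boundary_swapr => e.
by exists (- k); lia.
Qed.

End Local.

(** * Independence of the direction *)

Section Basis.
Variables (R : realType) (v u e : 'rV[R]_3).
Hypothesis vue : triple_product v u e != 0.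

Lemma coord_in_linear (i : 'I_3) s a b :
  coord_in v u e (s *: a + b) 0 i = s * coord_in v u e a 0 i + coord_in v u e b 0 i.
Proof. by rewrite /coord_in mulmxDl -scalemxAl 2!mxE. Qed.

Lemma triple_product_coordE a b c : triple_product a b c =
  (coord_in v u e a 0 0 * (coord_in v u e b 0 1 * coord_in v u e c 0 2%:R
     - coord_in v u e b 0 2%:R * coord_in v u e c 0 1)
  - coord_in v u e a 0 1 * (coord_in v u e b 0 0 * coord_in v u e c 0 2%:R
     - coord_in v u e b 0 2%:R * coord_in v u e c 0 0)
  + coord_in v u e a 0 2%:R * (coord_in v u e b 0 0 * coord_in v u e c 0 1
     - coord_in v u e b 0 1 * coord_in v u e c 0 0)) * triple_product v u e.
Proof. by rewrite (triple_product_coord vue) triple_productE. Qed.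

Lemma coord_in_line1 w : (exists k, w = k *: v) <->
  coord_in v u e w 0 1 = 0 /\ coord_in v u e w 0 2%:R = 0.
Proof.
have [cv _ _] := coord_in1 vue; split=> [[k ->]|[w1 w2]].
  rewrite -[k *: v]addr0 !coord_in_linear cv /coord_in mul0mx !mxE /=.
  by rewrite !mulr0 !addr0.
exists (coord_in v u e w 0 0).
by rewrite {1}(coord_inK vue w) w1 w2 !scale0r !addr0.
Qed.

Lemma coord_in_line2 w : (exists k, w = k *: u) <->
  coord_in v u e w 0 0 = 0 /\ coord_in v u e w 0 2%:R = 0.
Proof.
have [_ cu _] := coord_in1 vue; split=> [[k ->]|[w1 w2]].
  rewrite -[k *: u]addr0 !coord_in_linear cu /coord_in mul0mx !mxE /=.
  by rewrite !mulr0 !addr0.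
exists (coord_in v u e w 0 1).
by rewrite {1}(coord_inK vue w) w1 w2 !scale0r !add0r addr0.
Qed.

(** Equal heights put [p - q] in the plane of [v] and [u]. Not being a multiple of [v], it would
    span this plane together with [v], and [u] would be in their span. *)
Lemma level_neq p q : (forall k, p - q <> k *: v) ->
  (forall x y, u <> x *: (p - q) + y *: v) ->
  coord_in v u e p 0 2%:R != coord_in v u e q 0 2%:R.
Proof.
move=> pq upq; apply/eqP => epq.
have {epq} : coord_in v u e (p - q) 0 2%:R = 0.
  by rewrite addrC -scaleN1r coord_in_linear epq mulN1r addNr.
have := coord_inK vue (p - q); move: (coord_in _ _ _ _) => c d c2.
rewrite c2 scale0r addr0 in d.
have [c1|c1] := eqVneq (c 0 1) 0.
  by apply: (pq (c 0 0)); rewrite d c1 scale0r addr0.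
apply: (upq (c 0 1)^-1 (- (c 0 1)^-1 * c 0 0)).
rewrite {1}d scalerDr !scalerA mulVf // scale1r mulNr scaleNr.
by rewrite addrAC subrr add0r.
Qed.

End Basis.

Lemma basis_exists (R : realType) (v u : 'rV[R]_3) :
  v != 0 -> (forall x, u <> x *: v) -> exists e, triple_product v u e != 0.
Proof.
move=> v0 uv; have [e He] := off_spans_exists [:: v; u].
exists e; apply: triple_product_basis => // x y.
by apply: He; rewrite !inE eqxx ?orbT.
Qed.

Definition differences (V : zmodType) (P : seq V) : seq V :=
  [seq p - q | p <- P, q <- P].

Lemma mem_differences (V : zmodType) (P : seq V) p q :
  p \in P -> q \in P -> p - q \in differences P.
Proof. by move=> hp hq; apply/allpairsP; exists (p, q). Qed.

(** A common projection writes [k *: u], with [k] nonzero by disjointness, as a combination of three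
    differences. If a parameter is 0 or 1 or the triple product vanishes, two differences suffice,
    against genericity. *)
Lemma off_spans_transversal (R : realType) (P : seq 'rV[R]_3) u f g :
  off_spans (differences P) u -> f.1 \in P -> f.2 \in P -> g.1 \in P -> g.2 \in P ->
  disjoint_segments f g -> transversal_pair u f g.
Proof.
move=> offu f1 f2 g1 g2 dj s t [hs ht [k e]].
have k0 : k != 0.
  by apply: contra (dj s t hs ht) => /eqP k0; rewrite -subr_eq0 e k0 scale0r.
have no p q r z x y : p \in P -> q \in P -> r \in P -> z \in P ->
    k *: u <> x *: (p - q) + y *: (r - z).
  move=> hp hq hr hz /(congr1 (fun w => k^-1 *: w)).
  rewrite scalerA mulVf // scale1r scalerDr !scalerA.
  by apply: offu; apply: mem_differences.
have eA : k *: u = 1 *: (f.1 - g.1) + s *: (f.2 - f.1) - t *: (g.2 - g.1).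
  by rewrite -e /seg_pt; apply/rowP => i; rewrite !mxE; ring.
split.
- rewrite !lt_neqAle; case/andP: (hs) => -> ->; rewrite !andbT.
  apply/andP; split; apply/eqP => es.
    apply: (no f.1 g.1 g.2 g.1 1 (- t)) => //.
    by rewrite eA -es scale0r addr0 scaleNr.
  apply: (no f.2 g.1 g.2 g.1 1 (- t)) => //.
  by rewrite eA es; apply/rowP => i; rewrite !mxE; ring.
- rewrite !lt_neqAle; case/andP: (ht) => -> ->; rewrite !andbT.
  apply/andP; split; apply/eqP => es.
    apply: (no f.1 g.1 f.2 f.1 1 s) => //.
    by rewrite eA -es scale0r subr0.
  apply: (no f.1 g.2 f.2 f.1 1 s) => //.
  by rewrite eA es; apply/rowP => i; rewrite !mxE; ring.
apply: triple_product_basis => [|x xE|x y].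
- apply/eqP => A0; apply: (no f.1 g.1 g.2 g.1 1 (- t)) => //.
  by rewrite eA A0 scaler0 addr0 scaleNr.
- apply: (no f.1 g.1 f.2 f.1 1 (s - t * x)) => //.
  by rewrite eA xE scalerA scalerBl addrA.
by apply: offu; apply: mem_differences.
Qed.

Lemma off_spans_neq0 (R : realType) (S : seq 'rV[R]_3) u d :
  d \in S -> off_spans S u -> u != 0.
Proof.
by move=> dS /(_ _ _ dS dS 0 0) H; apply/eqP => u0; apply: H; rewrite u0 !scale0r addr0.
Qed.

Lemma crossing_sumE (R : realType) (P Q : seq 'rV[R]_3) v :
  crossing_sum P Q v
  = \sum_(f <- sides P) \sum_(g <- sides Q) strand_crossing v f g.
Proof. by apply: eq_bigr => f _; rewrite big_mkcond. Qed.

Lemma sum_sides (R : realType) (P : seq 'rV[R]_3) (F : 'rV[R]_3 -> int) :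
  \sum_(f <- sides P) (F f.2 - F f.1) = 0.
Proof.
rewrite sumrB /sides.
have H1 : \sum_(f <- zip P (rot 1 P)) F f.1 = \sum_(p <- P) F p.
  by rewrite -(big_map fst xpredT F) -/(unzip1 _) unzip1_zip ?size_rot.
have H2 : \sum_(f <- zip P (rot 1 P)) F f.2 = \sum_(p <- rot 1 P) F p.
  by rewrite -(big_map snd xpredT F) -/(unzip2 _) unzip2_zip ?size_rot.
rewrite H1 H2 (perm_big P) ?subrr //; by rewrite perm_rot.
Qed.

Lemma sum_level_boundary_sides (R : realType) (P Q : seq 'rV[R]_3) Z th :
  \sum_(f <- sides P) \sum_(g <- sides Q) level_boundary Z th f g = 0.
Proof.
under eq_bigr do rewrite big_split /=; rewrite big_split /= exchange_big /=.
rewrite !big1 ?addr0 // => [f _|g _]; first exact: (sum_sides Q (level_r Z th f)).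
exact: (sum_sides P (fun p => level_l Z th p g)).
Qed.

Lemma mem_sides (R : realType) (P : seq 'rV[R]_3) f :
  f \in sides P -> f.1 \in P /\ f.2 \in P.
Proof.
move=> hf; have := map_f fst hf; have := map_f snd hf.
by rewrite -/(unzip1 _) -/(unzip2 _) unzip1_zip ?unzip2_zip ?size_rot // mem_rot.
Qed.

Lemma sides_mem (R : realType) (P : seq 'rV[R]_3) p :
  p \in P -> exists2 f, f \in sides P & f.1 = p.
Proof.
move=> pP; have : p \in unzip1 (sides P) by rewrite unzip1_zip ?size_rot.
by case/mapP => f hf ->; exists f.
Qed.

Definition disjoint_polygons (R : realType) (P Q : seq 'rV[R]_3) :=
  forall f g, f \in sides P -> g \in sides Q -> disjoint_segments f g.

(** Vertices are the points with parameter 0 on sides, and regularity excludes this parameter. *)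
Lemma regular_not_parallel (R : realType) (P Q : seq 'rV[R]_3) v p q k :
  regular_direction P Q v -> p \in P -> q \in Q -> p - q <> k *: v.
Proof.
move=> [_ tr] /sides_mem [f hf <-] /sides_mem [g hg <-] e.
have [] := tr f g 0 0 hf hg; last by rewrite ltxx.
by split; rewrite ?lexx ?ler01 // !seg_pt0; exists k.
Qed.

(** The difference of the two sums is a sum of [level_boundary] over closed polygons, hence 0. The
    last hypothesis and the regularity of [v] keep the vertices of [P] and [Q] at different
    heights. *)
Lemma crossing_sum_change (R : realType) (P Q : seq 'rV[R]_3) v u :
  regular_direction P Q v -> regular_direction P Q u ->
  (forall x, u <> x *: v) ->
  (forall p q x y, p \in P -> q \in Q -> u <> x *: (p - q) + y *: v) ->
  crossing_sum P Q v = crossing_sum P Q u.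
Proof.
move=> regv regu uv upq; have [v0 trv] := regv; have [_ tru] := regu.
have [e vue] := basis_exists v0 uv.
apply/eqP; rewrite -subr_eq0 !crossing_sumE -sumrB.
under eq_bigr do rewrite -sumrB.
apply/eqP.
pose X w := coord_in v u e w 0 0; pose Y w := coord_in v u e w 0 1.
pose Z w := coord_in v u e w 0 2%:R.
have neZ p q : p \in P -> q \in Q -> Z p != Z q.
  move=> hp hq; apply: level_neq => // [k|x y]; last exact: upq.
  exact: regular_not_parallel regv hp hq.
transitivity (sgz (triple_product v u e) * \sum_(f <- sides P) \sum_(g <- sides Q)
    level_boundary Z (fun w => (0 < X w * Y w)%R%:Z) f g); last first.
  by rewrite sum_level_boundary_sides mulr0.
rewrite mulr_sumr; apply: eq_big_seq => f hf.
rewrite mulr_sumr; apply: eq_big_seq => g hg.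
have [f1 f2] := mem_sides hf; have [g1 g2] := mem_sides hg.
apply: direction_change.
- exact: coord_in_linear.
- exact: coord_in_linear.
- exact: coord_in_linear.
- exact: triple_product_coordE.
- exact: coord_in_line1.
- exact: coord_in_line2.
- by split; apply: neZ.
- by move=> s t; apply: trv.
- by move=> s t; apply: tru.
Qed.

(** The directions [v] and [w] may be parallel or in special position, so both are compared with a
    third, generic one. *)
Lemma crossing_sum_indep (R : realType) (P Q : seq 'rV[R]_3) v w :
  disjoint_polygons P Q -> regular_direction P Q v -> regular_direction P Q w ->
  crossing_sum P Q v = crossing_sum P Q w.
Proof.
move=> dj regv regw.
have [u offu] := off_spans_exists (v :: w :: differences (P ++ Q)).
have regu : regular_direction P Q u.
  split; first by apply: off_spans_neq0 offu; apply: mem_head.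
  move=> f g s t hf hg; have [f1 f2] := mem_sides hf; have [g1 g2] := mem_sides hg.
  apply: (@off_spans_transversal _ (P ++ Q)); rewrite ?mem_cat ?f1 ?f2 ?g1 ?g2 ?orbT //.
    by move=> d1 d2 h1 h2; apply: offu; rewrite !inE ?h1 ?h2 !orbT.
  exact: dj.
have span_ok x : x \in [:: v; w] -> (forall k, u <> k *: x) /\
    (forall p q k l, p \in P -> q \in Q -> u <> k *: (p - q) + l *: x).
  move=> hx; have hx' : x \in v :: w :: differences (P ++ Q).
    by move: hx; rewrite !inE => /orP[]->; rewrite ?orbT.
  split=> [k e|p q k l hp hq].
    by apply: (offu _ _ hx' hx' k 0); rewrite scale0r addr0.
  apply: offu => //; rewrite !inE mem_differences ?orbT // mem_cat ?hp ?hq ?orbT //.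
have [h1 h2] := span_ok v (mem_head _ _).
have [h3 h4] := span_ok w (mem_last _ [:: w]).
transitivity (crossing_sum P Q u); first exact: crossing_sum_change.
by apply/esym; exact: crossing_sum_change.
Qed.

Lemma linking_numberE (R : realType) (P Q : seq 'rV[R]_3) v :
  disjoint_polygons P Q -> regular_direction P Q v ->
  linking_number P Q = (crossing_sum P Q v)%:~R / 2.
Proof.
move=> dj regv; rewrite /linking_number; congr (_%:~R / _).
apply: crossing_sum_indep => //.
exact: (xgetPex (P := [set v | regular_direction P Q v]%classic) 0 (ex_intro _ v regv)).
Qed.

(** * Crossings of arcs *)

Definition open_sides (V : Type) (p : seq V) : seq (V * V) := zip p (behead p).

Lemma open_sides_closed (V : Type) (x y : V) l :
  open_sides (x :: rcons l y) = zip (x :: l) (rcons l y).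
Proof.
rewrite /open_sides /= -rcons_cons -cats1 -[rcons l y in LHS]cats0.
by rewrite zip_cat ?size_rcons //= cats0.
Qed.

Lemma open_sides_rcons2 (V : Type) (p : seq V) a b :
  open_sides (rcons (rcons p a) b) = rcons (open_sides (rcons p a)) (a, b).
Proof.
elim: p => [|c p IH] //.
have -> : open_sides (rcons (rcons (c :: p) a) b)
    = (c, head a p) :: open_sides (rcons (rcons p a) b) by case: p {IH}.
by rewrite IH; case: p {IH}.
Qed.

Lemma open_sides_rev (V : Type) (p : seq V) :
  open_sides (rev p) = rev (map (@swap_pair V) (open_sides p)).
Proof.
elim: p => [|a [|b p] IH] //.
by rewrite !rev_cons open_sides_rcons2 -rev_cons IH -rev_cons.
Qed.

Lemma sum_open_sides (V : eqType) (F : V -> int) x y l :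
  \sum_(a <- open_sides (x :: rcons l y)) (F a.2 - F a.1) = F y - F x.
Proof.
elim: l x => [|z l IH] x; first by rewrite /open_sides /= big_seq1.
rewrite (_ : open_sides _ = (x, z) :: open_sides (z :: rcons l y)) //.
by rewrite big_cons IH /= addrC subrKA.
Qed.

Lemma mem_open_sides (V : eqType) (p : seq V) a :
  a \in open_sides p -> a.1 \in p /\ a.2 \in p.
Proof.
elim: p => [|b [|c p] IH] //.
rewrite (_ : open_sides _ = (b, c) :: open_sides (c :: p)) // inE.
move=> /orP[/eqP ->|/IH [h1 h2]]; first by rewrite /= !inE !eqxx orbT.
by rewrite !(in_cons b) h1 h2 !orbT.
Qed.

Lemma on_line_open_sides (R : realType) (p : seq 'rV[R]_3) a s :
  a \in open_sides p -> 0 <= s <= 1 -> on_line p (seg_pt a.1 a.2 s).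
Proof.
move=> ap hs; have sz : (index a (open_sides p) < size (open_sides p))%N.
  by rewrite index_mem.
exists (index a (open_sides p)), s; move: sz; rewrite size_zip size_behead.
move: (index _ _) (nth_index (0, 0) ap) => k ak kp.
have {}kp : (k.+1 < size p)%N by move: kp; case: (size p) => //= n; lia.
split=> //; rewrite -ak /open_sides nth_zip_cond size_zip size_behead.
by rewrite leq_min (ltnW kp) -ltnS; case: (size p) kp => //= n ->; rewrite nth_behead.
Qed.

Lemma zip_flatten_map (T V W : Type) (F : T -> seq V) (G : T -> seq W) s :
  (forall x, size (F x) = size (G x)) ->
  zip (flatten (map F s)) (flatten (map G s))
  = flatten [seq zip (F x) (G x) | x <- s].
Proof. by move=> FG; elim: s => //= x s IH; rewrite zip_cat ?IH. Qed.

(** The rotation moves the head of each block to the end of the preceding one. This cuts the sides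
    of a closed polygon into the sides of its arcs. *)
Lemma rot1_flatten (T : eqType) (V : Type) (N : T -> T) (F : T -> V)
    (B : T -> seq V) c : fcycle N c ->
  rot 1 (flatten [seq F i :: B i | i <- c])
  = flatten [seq rcons (B i) (F (N i)) | i <- c].
Proof.
case: c => [|a c] //.
rewrite [cycle _ _]/= => cN; rewrite map_cons [flatten _]/= rot1_cons.
have H z : fpath N a (rcons c z) ->
    F a :: rcons (B a ++ flatten [seq F i :: B i | i <- c]) (F z)
    = F a :: flatten [seq rcons (B i) (F (N i)) | i <- a :: c].
  elim: c a {cN} => [|b c IH] a /= /andP[/eqP Na].
    by rewrite !cats0 Na.
  move=> /IH [<-]; rewrite Na /= -!cats1 /= -!catA /=.
  by rewrite -catA.
by case: (H a cN).
Qed.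

Lemma sides_cycle_polygon (R : realType) (T : finType) (e : rel T)
    (f : pl_embedding R e) c : uniq c ->
  sides (cycle_polygon f c)
  = flatten [seq open_sides (arc_line (vtx f) (bend f) i (next c i)) | i <- c].
Proof.
move=> uc; rewrite /sides /cycle_polygon.
rewrite (rot1_flatten (vtx f) (fun i => bend f i (next c i)) (cycle_next uc)).
rewrite zip_flatten_map => [|x]; last by rewrite size_rcons.
by congr flatten; apply: eq_map => i; rewrite open_sides_closed.
Qed.

Section Arcs.
Variables (R : realType) (r : nat) (f : pl_embedding R (@complete_graph r)).
Implicit Types (i j k l m : 'I_r) (v : 'rV[R]_3).

Notation arc := (arc_line (vtx f) (bend f)).

(** The pairs of equal vertices are included: the list [arc i i] shows directly that [vtx f i] is a
    member. *)
Definition arc_points : seq 'rV[R]_3 :=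
  flatten [seq arc ij.1 ij.2 | ij <- enum {: 'I_r * 'I_r}].

Lemma mem_arc_points i j p : p \in arc i j -> p \in arc_points.
Proof. by move=> h; apply/flatten_mapP; exists (i, j); rewrite ?mem_enum. Qed.

Definition arc_crossings v i j k l : int :=
  \sum_(a <- open_sides (arc i j)) \sum_(b <- open_sides (arc k l))
    strand_crossing v a b.

Lemma arc_disjoint i j k l a b : uniq [:: i; j; k; l] ->
  a \in open_sides (arc i j) -> b \in open_sides (arc k l) ->
  disjoint_segments a b.
Proof.
rewrite /= !inE !negb_or => /and4P[/and3P[ij ik il] /andP[jk jl] kl _] ha hb s t hs ht.
apply/eqP => e.
have := @arc_meet _ _ _ f i j k l.
move=> /(_ _ ij kl (on_line_open_sides ha hs)); rewrite e.
move=> /(_ (on_line_open_sides hb ht)) [/setP /(_ i)|[m]].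
  by rewrite !inE eqxx (negPf ik) (negPf il).
rewrite !inE => /andP[/orP[]/eqP->]; first by rewrite (negPf ik) (negPf il).
by rewrite (negPf jk) (negPf jl).
Qed.

Lemma arc_transversal v i j k l a b : off_spans (differences arc_points) v ->
  uniq [:: i; j; k; l] ->
  a \in open_sides (arc i j) -> b \in open_sides (arc k l) ->
  transversal_pair v a b.
Proof.
move=> offv u ha hb; have [a1 a2] := mem_open_sides ha.
have [b1 b2] := mem_open_sides hb.
apply: (off_spans_transversal offv); try exact: (mem_arc_points (i := i) (j := j));
  try exact: (mem_arc_points (i := k) (j := l)).
exact: arc_disjoint ha hb.
Qed.

Lemma arc_crossings_sym v i j k l :
  arc_crossings v k l i j = arc_crossings v i j k l.
Proof.
rewrite /arc_crossings exchange_big; apply: eq_bigr => a _; apply: eq_bigr => b _.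
exact: strand_crossing_sym.
Qed.

Lemma arc_crossings_rev v i j k l : i != j ->
  arc_crossings v j i k l = - arc_crossings v i j k l.
Proof.
move=> ij; rewrite /arc_crossings.
have -> : arc j i = rev (arc i j).
  by rewrite /arc_line (@bend_rev _ _ _ f i j) // rev_cons rev_rcons rcons_cons.
rewrite open_sides_rev (perm_big (map (@swap_pair _) (open_sides (arc i j)))) /=;
  last by rewrite perm_rev.
rewrite big_map -sumrN; apply: eq_bigr => a _; rewrite -sumrN.
by apply: eq_bigr => b _; rewrite strand_crossing_swapl.
Qed.

Lemma cycle_edge c i : oriented_cycle (@complete_graph r) c -> i \in c ->
  i != next c i /\ next c i \in c.
Proof.
move=> [_ /andP[cc _]] ic; rewrite mem_next; split=> //.
exact: (next_cycle cc ic).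
Qed.

(** A direction generic for all arcs is regular for every pair of disjoint cycles at once, and the
    sum over sides splits along the arcs. *)
Lemma linking_number_arcs v c d : off_spans (differences arc_points) v ->
  oriented_cycle (@complete_graph r) c -> oriented_cycle (@complete_graph r) d ->
  [disjoint c & d] ->
  linking_number (cycle_polygon f c) (cycle_polygon f d)
  = (\sum_(i <- c) \sum_(k <- d)
       arc_crossings v i (next c i) k (next d k))%:~R / 2.
Proof.
move=> offv cc cd dis.
have [_ /andP[_ uc]] := cc; have [_ /andP[_ ud]] := cd.
have ucd i k : i \in c -> k \in d -> uniq [:: i; next c i; k; next d k].
  move=> ic kd; have [e1 nc] := cycle_edge cc ic; have [e2 nd] := cycle_edge cd kd.
  have ne x y : x \in c -> y \in d -> x != y.
    by move=> xc; apply: contraTneq => <-; rewrite (disjointFr dis xc).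
  by rewrite /= !inE !negb_or e1 e2 !ne.
have sidesP g : g \in sides (cycle_polygon f c) ->
    exists2 i, i \in c & g \in open_sides (arc i (next c i)).
  by rewrite sides_cycle_polygon // => /flatten_mapP.
have sidesP' g : g \in sides (cycle_polygon f d) ->
    exists2 i, i \in d & g \in open_sides (arc i (next d i)).
  by rewrite sides_cycle_polygon // => /flatten_mapP.
rewrite (@linking_numberE _ _ _ v); first last.
- split.
    have [i ic] : exists i, i \in c.
      by case: (c) cc => [[]|i c' _] //; exists i; rewrite mem_head.
    have hp : vtx f i \in arc_points by apply: (@mem_arc_points i i); rewrite mem_head.
    by apply: off_spans_neq0 offv; exact: (mem_differences hp hp).
  move=> a b s t /sidesP [i ic ha] /sidesP' [k kd hb].
  exact: (arc_transversal offv (ucd _ _ ic kd) ha hb).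
- by move=> a b /sidesP [i ic ha] /sidesP' [k kd hb]; apply: arc_disjoint ha hb; apply: ucd.
congr (_%:~R / _); rewrite crossing_sumE !sides_cycle_polygon //.
rewrite big_flatten big_map; apply: eq_bigr => i _.
rewrite /arc_crossings exchange_big big_flatten big_map; apply: eq_bigr => k _.
by rewrite exchange_big.
Qed.

End Arcs.

(** * Parity of the crossings of two arcs *)

Lemma sum_parity (T : eqType) (s : seq T) (F G : T -> int) :
  (forall x, x \in s -> exists K, F x = G x + 2 * K) ->
  exists K, \sum_(x <- s) F x = \sum_(x <- s) G x + 2 * K.
Proof.
elim: s => [|x s IH] H; first by exists 0; rewrite !big_nil.
have [K hK] := H x (mem_head _ _).
have [|K' hK'] := IH; first by move=> y ys; apply: H; rewrite inE ys orbT.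
by exists (K + K'); rewrite !big_cons hK hK'; ring.
Qed.

Section ArcParity.
Variables (R : realType) (r : nat) (f : pl_embedding R (@complete_graph r)).
Implicit Types (i j k l : 'I_r) (v : 'rV[R]_3).

Notation arc := (arc_line (vtx f) (bend f)).

(** For nonzero [k] the equation puts [v] in the span of two differences; [k = 0] would put the
    vertex on an arc that does not end there. *)
Lemma arc_level_off v i j (p : 'I_r) a (s k : R) :
  off_spans (differences (arc_points f)) v ->
  uniq [:: i; j; p] -> a \in open_sides (arc i j) -> 0 <= s <= 1 ->
  seg_pt a.1 a.2 s - vtx f p <> k *: v.
Proof.
rewrite /= !inE negb_or andbT => offv /andP[/andP[ij ip] jp] ha hs e.
have [a1 a2] := mem_open_sides ha.
have /(mem_arc_points (f := f)) hp : vtx f p \in arc p p by rewrite mem_head.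
have {a1}a1 := mem_arc_points a1; have {a2}a2 := mem_arc_points a2.
have [k0|k0] := eqVneq k 0.
  move: e; rewrite k0 scale0r => /eqP; rewrite subr_eq0 => /eqP e.
  have := @arc_vtx _ _ _ f i j p ij; rewrite -e.
  move=> /(_ (on_line_open_sides ha hs)).
  by rewrite !inE eq_sym (negPf ip) eq_sym (negPf jp).
apply: (offv _ _ (mem_differences a1 hp) (mem_differences a2 a1) k^-1 (k^-1 * s)).
rewrite -scalerA -scalerDr -[v in LHS]scale1r -(mulVf k0) -scalerA -e.
by congr (_ *: _); apply/rowP => x; rewrite /seg_pt !mxE; ring.
Qed.

(** Summed over the sides of two arcs, the boundary in [crossing_parity] telescopes to terms at the
    four end vertices. [lt] compares heights, and [E p k l] counts with signs the passings of the
    arc from [k] to [l] at the height of [p] on one side of [p]. The terms of [level_r] count those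
    on the other side. *)
Lemma arc_crossings_parity v : off_spans (differences (arc_points f)) v ->
  exists (lt : rel 'I_r) (E : 'I_r -> 'I_r -> 'I_r -> int),
    (forall p q, p != q -> lt p q = ~~ lt q p) /\
    forall i j k l, uniq [:: i; j; k; l] -> exists K,
      arc_crossings f v i j k l = E j k l - E i k l
        + ((lt l j)%:Z - (lt l i)%:Z - E l i j)
        - ((lt k j)%:Z - (lt k i)%:Z - E k i j) + 2 * K.
Proof.
(* Without vertices the claim is empty, and [v] could be 0. *)
move=> offv; have [i0 _|no] := pickP (@predT 'I_r); last first.
  by exists (fun _ _ => true), (fun _ _ _ => 0); split=> p; have := no p.
have [u offu] := off_spans_exists (v :: differences (arc_points f)).
have pd i : vtx f i \in arc_points f.
  by apply: (mem_arc_points (i := i) (j := i)); rewrite mem_head.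
have v0 : v != 0 by apply: off_spans_neq0 offv; exact: (mem_differences (pd i0) (pd i0)).
have uv x : u <> x *: v.
  by move=> e; apply: (offu v v _ _ x 0); rewrite ?mem_head // scale0r addr0.
have [e vue] := basis_exists v0 uv.
pose Y w := coord_in v u e w 0 1; pose Z w := coord_in v u e w 0 2%:R.
have neZ p q : p \in arc_points f -> q \in arc_points f -> p != q -> Z p != Z q.
  move=> hp hq pq; apply: level_neq => // [k ek|x y].
    have [k0|k0] := eqVneq k 0.
      by move: ek; rewrite k0 scale0r => /eqP; rewrite subr_eq0 (negPf pq).
    have hpq := mem_differences hp hq.
    apply: (offv _ _ hpq hpq k^-1 0).
    by rewrite ek scalerA mulVf // scale1r scale0r addr0.
  by apply: offu; rewrite inE ?mem_differences ?eqxx ?orbT.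
pose th w : int := (0 < Y w)%R%:Z.
pose lt p q := Z (vtx f p) < Z (vtx f q).
pose E p k l : int := \sum_(b <- open_sides (arc k l)) level_l Z th (vtx f p) b.
exists lt, E; split=> [p q pq|i j k l un].
  rewrite /lt -leNgt lt_neqAle neZ ?pd //.
  by apply: contra pq => /eqP /(@vtx_inj _ _ _ f) ->.
have un3 p : p \in [:: k; l] -> uniq [:: i; j; p].
  move: un; rewrite /= !inE !negb_or => /and4P[/and3P[-> ik il] /andP[jk jl] kl _].
  by case/orP=> /eqP ->; rewrite ?ik ?il ?jk ?jl.
have sumr p : p \in [:: k; l] ->
    \sum_(a <- open_sides (arc i j)) level_r Z th a (vtx f p)
    = (lt p j)%:Z - (lt p i)%:Z - E p i j.
  move=> hp; rewrite /lt /E.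
  (* The signed number of all passings, on both sides of [p], depends only on the heights of the
     ends of the arc. *)
  rewrite -(@sum_open_sides _ (fun q => (Z (vtx f p) < Z q)%R%:Z) _ _ (bend f i j)).
  rewrite -sumrB; apply: eq_big_seq => a ha.
  rewrite /level_r /level_l -/(passing Z (vtx f p) a).
  have [ps|ps] := eqVneq (passing Z (vtx f p) a) 0; first by rewrite ps !mul0r.
  rewrite -{2}[passing _ _ _]mulr1 -mulrBr; congr (_ * _).
  have na : Z a.1 != Z a.2 by apply: contra ps => /eqP /passing_eq ->.
  (* A nonzero [passing] places the level point on the side itself and not only on its line. *)
  have [s [hs sE ls]] : exists s, [/\ 0 <= s <= 1,
      level_pt Z a (vtx f p) = seg_pt a.1 a.2 s &
      s * (Z a.2 - Z a.1) = Z (vtx f p) - Z a.1].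
    exists ((Z (vtx f p) - Z a.1) / (Z a.2 - Z a.1)); split=> //; last first.
      by rewrite divfK // subr_eq0 eq_sym.
    move: ps; rewrite /passing; case: ltrP => h2; case: ltrP => h1 //= _.
      have P : 0 < Z a.2 - Z a.1 by lra.
      by rewrite ler_pdivlMr // ler_pdivrMr //; lra.
    have P : Z a.2 - Z a.1 < 0 by rewrite subr_lt0 lt_neqAle eq_sym na; lra.
    by rewrite ler_ndivlMr // ler_ndivrMr //; lra.
  rewrite sE.
  (* Otherwise this horizontal vector would be parallel to [v]. Hence exactly one of the two sides
     of [p] is counted. *)
  have nY : Y (seg_pt a.1 a.2 s - vtx f p) != 0.
    apply/eqP => Y0.
    have [c] : exists c, seg_pt a.1 a.2 s - vtx f p = c *: v.
      apply/(coord_in_line1 vue); split=> //.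
      have lin := coord_in_linear v u e 2%:R.
      rewrite /seg_pt addrC -scaleN1r !lin.
      have c0 : coord_in v u e 0 0 2%:R = 0 by rewrite /coord_in mul0mx mxE.
      rewrite -[_ *: a.2]addr0 lin c0.
      by rewrite -/(Z a.1) -/(Z a.2) -/(Z (vtx f p)); lra.
    by apply: (arc_level_off offv (un3 p hp) ha hs).
  rewrite /th -opprB.
  have -> : Y (- (vtx f p - seg_pt a.1 a.2 s)) = - Y (vtx f p - seg_pt a.1 a.2 s).
    by rewrite /Y /coord_in mulNmx mxE.
  have {}nY : Y (vtx f p - seg_pt a.1 a.2 s) != 0.
    by move: nY; rewrite -opprB /Y /coord_in mulNmx mxE oppr_eq0.
  by rewrite oppr_gt0; case: ltrgtP nY.
have [K HK] : exists K, arc_crossings f v i j k l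
   = \sum_(a <- open_sides (arc i j)) \sum_(b <- open_sides (arc k l))
        level_boundary Z th a b + 2 * K.
  rewrite /arc_crossings.
  have step a b : a \in open_sides (arc i j) -> b \in open_sides (arc k l) ->
      exists K, strand_crossing v a b = level_boundary Z th a b + 2 * K.
    move=> ha hb; have [a1 a2] := mem_open_sides ha; have [b1 b2] := mem_open_sides hb.
    have dj := arc_disjoint un ha hb; have tr := arc_transversal offv un ha hb.
    have ends (p q : 'rV[R]_3) (s t : R) : 0 <= s <= 1 -> 0 <= t <= 1 ->
        p = seg_pt a.1 a.2 s -> q = seg_pt b.1 b.2 t ->
        p \in arc i j -> q \in arc k l -> Z p != Z q.
      move=> hs ht ep eq /mem_arc_points hp /mem_arc_points hq; apply: neZ => //.
      by rewrite ep eq dj.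
    have [s0 s1] : 0 <= (0 : R) <= 1 /\ 0 <= (1 : R) <= 1 by rewrite !lexx ler01.
    apply: (@crossing_parity _ Y Z v _ _ _ a b) => //; try exact: coord_in_linear.
      exact: coord_in_line1.
    split.
    - by apply: (ends _ _ 0 0); rewrite ?seg_pt0.
    - by apply: (ends _ _ 0 1); rewrite ?seg_pt0 ?seg_pt1.
    - by apply: (ends _ _ 1 0); rewrite ?seg_pt0 ?seg_pt1.
    - by apply: (ends _ _ 1 1); rewrite ?seg_pt1.
  apply: sum_parity => a ha; apply: sum_parity => b hb; exact: step.
exists K; rewrite HK; congr (_ + _).
under eq_bigr do rewrite /level_boundary big_split /=.
rewrite big_split /= exchange_big /=.
have -> : \sum_(b <- open_sides (arc k l)) \sum_(a <- open_sides (arc i j))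
    (level_l Z th a.2 b - level_l Z th a.1 b) = E j k l - E i k l.
  rewrite /E -sumrB; apply: eq_bigr => b _.
  exact: (@sum_open_sides _ (fun q => level_l Z th q b)).
rewrite -[RHS]addrA; congr (_ + _).
rewrite -!sumr ?inE ?eqxx ?orbT // -sumrB; apply: eq_bigr => a _.
exact: (@sum_open_sides _ (fun q => level_r Z th a q)).
Qed.

End ArcParity.

(** * Ramsey's theorem *)

(** Take the first element [y], thin out the rest until all its subsequences of length [s] have the
    same color after [y], and go on inside. Each chosen element is stored with the color it forces
    on the longer subsequences that it begins. *)
Lemma ramsey_pairs (C : finType) (s : nat) :
  (forall N, exists r, forall (T : eqType) (col : seq T -> C) (L : seq T),
    (r <= size L)%N -> exists P c, [/\ subseq P L, size P = N &
      forall t, subseq t P -> size t = s -> col t = c]) ->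
  forall m, exists r, forall (T : eqType) (col : seq T -> C) (L : seq T),
    (r <= size L)%N -> exists Zs : seq (T * C),
    [/\ subseq (unzip1 Zs) L, size Zs = m &
      forall z zs, subseq (z :: zs) Zs -> size zs = s ->
        col (z.1 :: unzip1 zs) = z.2].
Proof.
move=> IHs; elim=> [|m [r Hr]].
  by exists 0%N => T col L _; exists [::]; split=> //; apply: sub0seq.
have [r' Hr'] := IHs r.
exists r'.+1 => T col [|y L] //= sL.
have [P [c [PL sP cP]]] := Hr' T (fun t => col (y :: t)) L sL.
have [Zs [ZP sZ cZ]] := Hr T col P (eq_leq (esym sP)).
exists ((y, c) :: Zs); split=> [||z zs].
- by rewrite /= eqxx; apply: subseq_trans ZP PL.
- by rewrite /= sZ.
rewrite [subseq _ _]/=; case: eqP => [-> zZ szs|_]; last exact: cZ.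
by apply: cP; rewrite ?size_map //; apply: subseq_trans ZP; apply: map_subseq.
Qed.

Lemma pigeonhole_color (T : Type) (C : finType) (col : T -> C) (N : nat) (s : seq T) :
  (#|C| * N < size s)%N -> exists c, (N < count (fun x => col x == c) s)%N.
Proof.
move=> sN; apply/existsP; apply: contraTT sN => /existsPn H.
rewrite -leqNgt -sum1_size (partition_big col xpredT) //= -sum_nat_const.
apply: leq_sum => c _; rewrite sum1_count leqNgt.
by have := H c; congr (~~ (_ < _)%N); apply: eq_count => x.
Qed.

(** In the sequence from [ramsey_pairs] the color depends on the first entry only, so the pigeonhole
    principle finishes. The bound [r] precedes [T], because the result is applied to ['I_r]
    itself. *)
Lemma ramsey (C : finType) (s N : nat) :
  exists r, forall (T : eqType) (col : seq T -> C) (L : seq T),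
    (r <= size L)%N -> exists P c, [/\ subseq P L, size P = N &
      forall t, subseq t P -> size t = s -> col t = c].
Proof.
elim: s N => [|s IHs] N.
  exists N => T col L sL; exists (take N L), (col [::]); split.
  - exact: take_subseq.
  - by rewrite size_takel.
  - by move=> t _ /size0nil ->.
have [r Hr] := ramsey_pairs IHs (#|C| * N).+1.
exists r => T col L /(Hr _ col) [Zs [ZL sZ cZ]].
have [c Nc] := @pigeonhole_color _ C snd N Zs (eq_leq (esym sZ)).
set Y := filter (fun z : T * C => z.2 == c) Zs.
have YZ : subseq (take N Y) Zs.
  by apply: subseq_trans (take_subseq _ _) (filter_subseq _ _).
exists (unzip1 (take N Y)), c; split.
- exact: subseq_trans (map_subseq _ YZ) ZL.
- by rewrite size_map size_takel // size_filter ltnW.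
move=> t /subseqP [b _ ->]; rewrite /unzip1 -map_mask => st.
have sub := mask_subseq b (take N Y).
move: st sub; case: (mask b _) => [|z zs] //=; rewrite size_map => -[szs] sub.
rewrite (cZ z zs) //; last exact: subseq_trans sub YZ.
have /(mem_subseq (take_subseq _ _)) : z \in take N Y.
  by rewrite (mem_subseq sub) ?mem_head.
by rewrite mem_filter => /andP[/eqP].
Qed.

(** * Woven cycles *)

Lemma intr_Zp_inj (M : nat) (a b : int) : (1 < M)%N ->
  a%:~R = b%:~R :> 'Z_M -> exists q, a = b + q * M%:Z.
Proof.
move=> M1 /eqP; rewrite -subr_eq0 -intrB => /eqP ab.
suff [q qE] : exists q, a - b = q * M%:Z by exists q; rewrite -qE addrC subrK.
have nat0 m : m%:R = 0 :> 'Z_M -> exists q : int, m%:Z = q * M%:Z.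
  move=> /(congr1 (@nat_of_ord _)); rewrite val_Zp_nat // => m0.
  by exists (m %/ M)%N; rewrite -PoszM [X in X%:Z = _](divn_eq m M) m0 addn0.
case: (a - b) ab => m; first exact: nat0.
rewrite NegzE rmorphN => /eqP; rewrite oppr_eq0 => /eqP /nat0 [q ->].
by exists (- q); rewrite mulNr.
Qed.

Lemma subseq_nth (T : eqType) (x0 : T) (P : seq T) (s : seq nat) :
  sorted ltn s -> all (fun i => i < size P)%N s ->
  subseq [seq nth x0 P i | i <- s] P.
Proof.
move=> ss /allP sP; rewrite -[X in subseq _ X](mkseq_nth x0 P) /mkseq.
apply: map_subseq; apply/subseq_uniqP; first exact: iota_uniq.
apply: (irr_sorted_eq ltn_trans ltnn) => //.
  exact: sorted_filter ltn_trans _ _ (iota_ltn_sorted _ _).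
move=> i; rewrite mem_filter mem_iota /= add0n.
by apply/idP/andP => [h|[]] //; split=> //; apply: sP.
Qed.

Lemma uniq_cycle_neq (T : eqType) (c : seq T) :
  uniq c -> (1 < size c)%N -> cycle [rel i j | i != j] c.
Proof.
case: c => [|a c] // u s; rewrite /= rcons_path; apply/andP; split.
  have : pairwise [rel i j | i != j] (a :: c) by rewrite -uniq_pairwise.
  by move/pairwise_sorted.
case/lastP: c u s => [|c b] //= /andP[ac _] _; rewrite last_rcons.
by apply: contra ac => /eqP ->; rewrite mem_rcons mem_head.
Qed.

Lemma next_map_iota (T : eqType) (g : nat -> T) m t :
  {in gtn m &, injective g} -> (t < m)%N ->
  next [seq g i | i <- iota 0 m] (g t) = g (t.+1 %% m)%N.
Proof.
case: m => // m ginj tm; rewrite next_nth map_f ?mem_iota //.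
have -> : index (g t) [seq g i | i <- iota 0 m.+1] = t.
  have -> : g t = nth (g 0) [seq g i | i <- iota 0 m.+1] t.
    by rewrite (nth_map 0%N) ?size_iota // nth_iota.
  rewrite index_uniq ?size_map ?size_iota // map_inj_in_uniq ?iota_uniq //.
  by move=> i j; rewrite !mem_iota /= !add0n => hi hj; apply: ginj.
rewrite [iota _ _]/= map_cons; have [tm'|mt] := ltnP t m.
  by rewrite (nth_map 0%N) ?size_iota // nth_iota // modn_small.
have -> : t = m by apply/eqP; rewrite eqn_leq mt -ltnS tm.
by rewrite modnn nth_default // size_map size_iota.
Qed.

Lemma sum_pairs (F : nat -> int) k :
  \sum_(t <- iota 0 k.*2) F t = \sum_(i < k) (F i.*2 + F i.*2.+1).
Proof.
have -> : iota 0 k.*2 = index_iota 0 k.*2 by rewrite /index_iota subn0.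
elim: k => [|k IH]; first by rewrite big_ord0 big_geq.
by rewrite doubleS !big_nat_recr //= IH big_ord_recr /= addrA.
Qed.

Lemma sum_eq_indicator (i k : nat) : \sum_(j < k) (i == j :> nat)%:Z = (i < k)%N%:Z.
Proof.
elim: k => [|k IH]; first by rewrite big_ord0.
rewrite big_ord_recr /= IH ltnS; by case: ltngtP.
Qed.

(** Tells whether two strands have their lower blocks [a], [a'] and upper blocks [b], [b'] in the
    same order. Ties count as [<=], because the cycle of smaller index comes first within a
    block. *)
Definition agree (a b a' b' : nat) : int := ((a <= a')%N == (b <= b')%N).

(** Each cycle goes up from its lower block [i] to its upper block [i] and down again to the next
    lower block. The four pairs of such strands of two cycles are counted, with a minus sign for
    each downward strand. *)
Definition agree_diff k i j : int :=
  agree i i j j - agree (i.+1 %% k) i j j - agree i i (j.+1 %% k) j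
  + agree (i.+1 %% k) i (j.+1 %% k) j.

(** Shifting a lower end by one block alters the agreement only near the diagonal; the last term
    comes from the wrap-around at [j = k.-1]. *)
Lemma agree_diffE k i j : (1 < k)%N -> (i < k)%N -> (j < k)%N ->
  agree_diff k i j = (i == j)%:Z + (i == j.+1)%:Z - ((i == 0%N) && (k.-1 == j))%:Z.
Proof.
move=> k1 ik jk; rewrite /agree_diff /agree.
have mE m : (m < k)%N -> (m.+1 %% k)%N = if m.+1 == k then 0%N else m.+1.
  move=> mk; case: eqP => [->|]; first exact: modnn.
  by move=> /eqP nk; rewrite modn_small // ltn_neqAle nk.
have eqbE (b b' : bool) : (b == b')%:Z = 1 - b%:Z - b'%:Z + 2 * (b && b')%:Z.
  by case: b; case: b'.
by rewrite !mE // !eqbE; case: eqP => ei; case: eqP => ej; lia.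
Qed.

(** The diagonal contributes [k], the line next to it [k - 1] and the corner [-1]. *)
Lemma sum_agree_diff k : (1 < k)%N ->
  \sum_(i < k) \sum_(j < k) agree_diff k i j = (k.-1.*2)%:Z.
Proof.
move=> k1; transitivity (\sum_(i < k) (2 - 2 * (0%N == i :> nat)%:Z)).
  apply: eq_bigr => i _.
  under eq_bigr => j _ do rewrite agree_diffE //.
  rewrite sumrB big_split /= sum_eq_indicator ltn_ord.
  have -> : \sum_(j < k) ((i == 0 :> nat) && (k.-1 == j))%:Z = (0%N == i :> nat)%:Z.
    rewrite [RHS](_ : _ = (0%N == i :> nat)%:Z * (k.-1 < k)%N%:Z); last by lia.
    rewrite -sum_eq_indicator mulr_sumr; apply: eq_bigr => j _.
    by rewrite eq_sym; case: eqP; rewrite ?mul1r ?mul0r.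
  have -> : \sum_(j < k) (i == j.+1 :> nat)%:Z = 1 - (0%N == i :> nat)%:Z.
    case: i => -[|i] /= ik; first by rewrite big1.
    by under eq_bigr do rewrite eqSS; rewrite sum_eq_indicator ltnW.
  lia.
rewrite sumrB -mulr_sumr sum_eq_indicator sumr_const card_ord; lia.
Qed.

Lemma odd_multiple_norm (l : nat) (X d q : int) :
  X = 2 ^+ l * (2 * d + 1) + q * 2 ^+ l.+1 -> 2 ^+ l <= `|X|.
Proof.
rewrite exprS mulrCA mulrA -[2 * q]mulrC => ->.
have -> : 2 ^+ l * (2 * d + 1) + q * 2 * 2 ^+ l = 2 ^+ l * (2 * (d + q) + 1) :> int by ring.
rewrite normrM ger0_norm ?exprn_ge0 // ler_peMr ?exprn_ge0 //.
lia.
Qed.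

(** * Parity of homogeneous crossings *)

Section CrossingMatrix.
Variables (T : finType) (x : T -> T -> T -> T -> int).
Hypothesis x_sym : forall i j k l, x k l i j = x i j k l.
Hypothesis x_rev : forall i j k l, i != j -> x j i k l = - x i j k l.
Hypothesis x_parity : exists (lt : rel T) (E : T -> T -> T -> int),
  (forall p q, p != q -> lt p q = ~~ lt q p) /\
  forall i j k l, uniq [:: i; j; k; l] -> exists K,
    x i j k l = E j k l - E i k l
      + ((lt l j)%:Z - (lt l i)%:Z - E l i j)
      - ((lt k j)%:Z - (lt k i)%:Z - E k i j) + 2 * K.

Lemma homogeneous_parity (y : nat -> T) (al be ga : int) :
  {in gtn 6 &, injective y} ->
  (forall a b c d, (a < b < c)%N -> (c < d < 6)%N -> exists q1 q2 q3 : int,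
    [/\ x (y a) (y b) (y c) (y d) = al + 2 * q1,
        x (y a) (y c) (y b) (y d) = be + 2 * q2 &
        x (y a) (y d) (y b) (y c) = ga + 2 * q3]) ->
  exists d, be - ga = 2 * d + 1.
Proof.
move=> yinj H; have [lt [E [ltC xE]]] := x_parity.
have ne a b : (a < 6)%N -> (b < 6)%N -> a != b -> y a != y b.
  by move=> ha hb; apply: contra => /eqP /yinj -> //.
have un a b c d : (a < 6)%N -> (b < 6)%N -> (c < 6)%N -> (d < 6)%N ->
    uniq [:: a; b; c; d] -> uniq [:: y a; y b; y c; y d].
  move=> ha hb hc hd u; rewrite -[[:: y a; _; _; _]]/(map y [:: a; b; c; d]).
  rewrite map_inj_in_uniq // => p q; rewrite !inE.
  by move=> /or4P[] /eqP-> /or4P[] /eqP->; apply: yinj.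
pose L a b : int := lt (y a) (y b); pose e a b c := E (y a) (y b) (y c).
have LC a b : (a < 6)%N -> (b < 6)%N -> a != b -> L a b + L b a = 1.
  by move=> ha hb ab; rewrite /L (ltC (y a)) ?ne //; case: (lt _ _).
(* Modulo 2 all signs become [+]. *)
have key a b c d : (a < 6)%N -> (b < 6)%N -> (c < 6)%N -> (d < 6)%N ->
    uniq [:: a; b; c; d] -> exists K, x (y a) (y b) (y c) (y d)
      = e a c d + e b c d + e c a b + e d a b + L d b + L d a + L c b + L c a + 2 * K.
  move=> ha hb hc hd u; have [K ->] := xE _ _ _ _ (un _ _ _ _ ha hb hc hd u).
  exists (K - e a c d - e d a b - L d a - L c b); rewrite /e /L; ring.
have quad a b c d : (a < b < c)%N -> (c < d < 6)%N -> exists K1 K2 K3 : int,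
  [/\ al = e a c d + e b c d + e c a b + e d a b + L d b + L d a + L c b + L c a + 2 * K1,
      be = e a b d + e c b d + e b a c + e d a c + L d c + L d a + L b c + L b a + 2 * K2 &
      ga = e a b c + e d b c + e b a d + e c a d + L c d + L c a + L b d + L b a + 2 * K3].
  move=> abc cd6; have [q1 [q2 [q3 [e1 e2 e3]]]] := H _ _ _ _ abc cd6.
  have [K1 E1] := key a b c d
    ltac:(lia) ltac:(lia) ltac:(lia) ltac:(lia) ltac:(rewrite /= !inE; lia).
  have [K2 E2] := key a c b d
    ltac:(lia) ltac:(lia) ltac:(lia) ltac:(lia) ltac:(rewrite /= !inE; lia).
  have [K3 E3] := key a d b c
    ltac:(lia) ltac:(lia) ltac:(lia) ltac:(lia) ltac:(rewrite /= !inE; lia).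
  exists (K1 - q1), (K2 - q2), (K3 - q3).
  split.
  - by rewrite -[al](addrK (2 * q1)) -e1 E1; ring.
  - by rewrite -[be](addrK (2 * q2)) -e2 E2; ring.
  - by rewrite -[ga](addrK (2 * q3)) -e3 E3; ring.
(* Sum over the five quadruples of a K5: every [e] term occurs twice. In each quadruple three
   comparisons [L] occur once in both directions and the others twice in the same one, which leaves
   an odd number. *)
have [s sE] : exists s, al + be + ga = 2 * s + 1.
  have [a1 [a2 [a3 [A1 A2 A3]]]] := quad 0 1 2 3 erefl erefl.
  have [b1 [b2 [b3 [B1 B2 B3]]]] := quad 0 1 2 4 erefl erefl.
  have [c1 [c2 [c3 [C1 C2 C3]]]] := quad 0 1 3 4 erefl erefl.
  have [d1 [d2 [d3 [D1 D2 D3]]]] := quad 0 2 3 4 erefl erefl.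
  have [f1 [f2 [f3 [F1 F2 F3]]]] := quad 1 2 3 4 erefl erefl.
  have [s [sE|sE]] : exists s, al + be + ga = 2 * s + 1 \/ al + be + ga = 2 * s.
  - by exists ((al + be + ga) %/ 2)%Z; lia.
  - by exists s.
  have L10 := LC 1 0 erefl erefl erefl; have L20 := LC 2 0 erefl erefl erefl.
  have L30 := LC 3 0 erefl erefl erefl; have L40 := LC 4 0 erefl erefl erefl.
  have L21 := LC 2 1 erefl erefl erefl; have L31 := LC 3 1 erefl erefl erefl.
  have L41 := LC 4 1 erefl erefl erefl; have L32 := LC 3 2 erefl erefl erefl.
  have L42 := LC 4 2 erefl erefl erefl; have L43 := LC 4 3 erefl erefl erefl.
  exists s; clear H key quad LC un ne xE ltC yinj.
  move: e L A1 A2 A3 B1 B2 B3 C1 C2 C3 D1 D2 D3 F1 F2 F3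
    L10 L20 L30 L40 L21 L31 L41 L32 L42 L43 => {}e {}L *.
  lia.
(* Sum over the nine pairs of edges of the triangles 0, 1, 2 and 3, 4, 5: every [e] term occurs
   twice and every [L] term four times, so [9 * al] is even. *)
have [t tE] : exists t, al = 2 * t.
  have [s' [aE|aE]] : exists s, al = 2 * s \/ al = 2 * s + 1.
  - by exists (al %/ 2)%Z; lia.
  - by exists s'.
  have [a1 [_ [_ [A1 _ _]]]] := quad 0 1 3 4 erefl erefl.
  have [a2 [_ [_ [A2 _ _]]]] := quad 0 1 3 5 erefl erefl.
  have [a3 [_ [_ [A3 _ _]]]] := quad 0 1 4 5 erefl erefl.
  have [b1 [_ [_ [B1 _ _]]]] := quad 0 2 3 4 erefl erefl.
  have [b2 [_ [_ [B2 _ _]]]] := quad 0 2 3 5 erefl erefl.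
  have [b3 [_ [_ [B3 _ _]]]] := quad 0 2 4 5 erefl erefl.
  have [c1 [_ [_ [C1 _ _]]]] := quad 1 2 3 4 erefl erefl.
  have [c2 [_ [_ [C2 _ _]]]] := quad 1 2 3 5 erefl erefl.
  have [c3 [_ [_ [C3 _ _]]]] := quad 1 2 4 5 erefl erefl.
  exists s'; clear H key quad LC un ne xE ltC yinj sE.
  move: e L A1 A2 A3 B1 B2 B3 C1 C2 C3 => {}e {}L *.
  lia.
by exists (s - t - ga); lia.
Qed.

End CrossingMatrix.

(** * Crossings of two woven cycles *)

Section Woven.
Variables (T : finType) (x : T -> T -> T -> T -> int).
Hypothesis x_sym : forall i j k l, x k l i j = x i j k l.
Hypothesis x_rev : forall i j k l, i != j -> x j i k l = - x i j k l.
Variables (A : comNzRingType) (red : {additive int -> A}) (n k : nat) (y : nat -> T).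
Hypothesis y_inj : {in gtn (k.*2 * n)%N &, injective y}.
Hypothesis k1 : (1 < k)%N.

(* Cycle [c] visits one vertex of each block of [n] consecutive positions; the
   blocks come in the order 0, k, 1, k + 1, ..., k - 1, 2 k - 1. *)
Definition woven_pos (c t : nat) : nat := ((if odd t then k else 0) + t./2) * n + c.

Definition low c i : T := y (i * n + c)%N.
Definition high c i : T := y ((k + i) * n + c)%N.

Definition woven_cycle c : seq T := [seq y (woven_pos c t) | t <- iota 0 k.*2].

Lemma woven_pos_lt c t : (c < n)%N -> (t < k.*2)%N -> (woven_pos c t < k.*2 * n)%N.
Proof.
move=> cn tk; rewrite /woven_pos.
have H : ((if odd t then k else 0) + t./2 < k.*2)%N.
  have := odd_double_half t; case: (odd t) => /= ?; lia.
apply: leq_trans (_ : (((if odd t then k else 0) + t./2).+1 * n <= _)%N); last first.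
  by rewrite leq_mul2r H orbT.
by rewrite mulSn addnC ltn_add2r.
Qed.

Lemma woven_pos_inj c d t t' : (c < n)%N -> (d < n)%N -> (t < k.*2)%N ->
  (t' < k.*2)%N -> woven_pos c t = woven_pos d t' -> c = d /\ t = t'.
Proof.
move=> cn dn tk tk' e.
have ecd : c = d.
  by have := congr1 (modn^~ n) e; rewrite /woven_pos !modnMDl !modn_small.
split=> //; move: e; rewrite /woven_pos ecd => /addIn /eqP.
rewrite eqn_mul2r; have -> : n == 0%N = false by lia.
move=> /eqP /=; have := odd_double_half t; have := odd_double_half t'.
by case: (odd t); case: (odd t') => /= ? ? ?; lia.
Qed.

Lemma woven_inj c : (c < n)%N -> {in gtn k.*2 &, injective (fun t => y (woven_pos c t))}.
Proof.
move=> cn t t' ht ht' /y_inj e.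
by have [] := woven_pos_inj cn cn ht ht' (e _ _); rewrite //; apply: woven_pos_lt.
Qed.

Lemma woven_uniq c : (c < n)%N -> uniq (woven_cycle c).
Proof.
move=> cn; rewrite map_inj_in_uniq ?iota_uniq // => t t'.
by rewrite !mem_iota /= !add0n; apply: woven_inj.
Qed.

Lemma woven_disjoint c d : (c < n)%N -> (d < n)%N -> c != d ->
  [disjoint woven_cycle c & woven_cycle d].
Proof.
move=> cn dn cd; rewrite disjoint_has; apply/hasPn => _ /mapP [t ht ->].
apply/negP => /mapP [t' ht' e]; rewrite !mem_iota /= !add0n in ht ht'.
have [|ecd _] := woven_pos_inj cn dn ht ht'; last by rewrite ecd eqxx in cd.
by apply: y_inj e; apply: woven_pos_lt.
Qed.

Lemma sum_woven c (F : T -> T -> int) : (c < n)%N ->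
  \sum_(i <- woven_cycle c) F i (next (woven_cycle c) i)
  = \sum_(i < k) (F (low c i) (high c i) + F (high c i) (low c (i.+1 %% k))).
Proof.
move=> cn; rewrite {1}/woven_cycle big_map.
under eq_big_seq => t.
  rewrite mem_iota /= add0n => tk.
  rewrite (next_map_iota (g := fun t => y (woven_pos c t)) (woven_inj cn) tk).
  over.
rewrite (sum_pairs (fun t => F (y (woven_pos c t)) (y (woven_pos c (t.+1 %% k.*2))))).
apply: eq_bigr => i _; have ik := ltn_ord i.
have -> : (i.*2.+1 %% k.*2 = i.*2.+1)%N by rewrite modn_small //; lia.
have -> : (i.*2.+2 %% k.*2 = (i.+1 %% k).*2)%N.
  by rewrite -doubleS -!muln2 muln_modl.
by rewrite /woven_pos /low /high /= !odd_double /= uphalf_double !doubleK.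
Qed.

Variables (be ga : A).
Hypothesis y_be : forall a b c d, (a < b < c)%N -> (c < d < k.*2 * n)%N ->
  red (x (y a) (y c) (y b) (y d)) = be.
Hypothesis y_ga : forall a b c d, (a < b < c)%N -> (c < d < k.*2 * n)%N ->
  red (x (y a) (y d) (y b) (y c)) = ga.

(* Strands between a lower and an upper vertex are never separated: they form a
   (13, 24) pair if their lower and upper ends are ordered alike, and a (14, 23) pair
   otherwise. *)
Lemma woven_strands c d a b a' b' : (c < d < n)%N ->
  (a < k)%N -> (b < k)%N -> (a' < k)%N -> (b' < k)%N ->
  red (x (low c a) (high c b) (low d a') (high d b'))
  = ga + (be - ga) *~ agree a b a' b'.
Proof.
move=> cdn ak bk ak' bk'.
have lex p q : (p * n + c < q * n + d)%N = (p <= q)%N.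
  by have [pq|qp] := leqP p q; [have := leq_mul pq (leqnn n)
                              | have := leq_mul qp (leqnn n)]; lia.
have lex' p q : (q * n + d < p * n + c)%N = (q < p)%N.
  by have [pq|qp] := leqP p q; [have := leq_mul pq (leqnn n)
                              | have := leq_mul qp (leqnn n)]; lia.
have sep p q e e' : (p < k)%N -> (e < n)%N -> (p * n + e < (k + q) * n + e')%N.
  by move=> pk en; have := leq_mul (leq_trans pk (leq_addr q k)) (leqnn n); lia.
have top q e : (q < k)%N -> (e < n)%N -> ((k + q) * n + e < k.*2 * n)%N.
  move=> qk en; have : ((k + q).+1 * n <= k.*2 * n)%N by apply: leq_mul => //; lia.
  lia.
rewrite /agree /low /high; case: leqP => h1; case: leqP => h2;
  rewrite /= ?mulr1z ?mulr0z ?addr0 ?[ga + _]addrC ?subrK.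
- by rewrite y_be //; apply/andP; split; rewrite ?lex ?sep ?top //; lia.
- by rewrite y_ga //; apply/andP; split; rewrite ?lex ?lex' ?sep ?top //; lia.
- by rewrite -x_sym y_ga //; apply/andP; split; rewrite ?lex ?lex' ?sep ?top //; lia.
- by rewrite -x_sym y_be //; apply/andP; split; rewrite ?lex ?lex' ?sep ?top //; lia.
Qed.

(** All strands are directed upwards at the cost of signs. In each group of four pairs two signs are
    positive and two negative, so [ga] cancels and the coefficients of [be - ga] form
    [agree_diff]. *)
Lemma sum_woven_pair c d : (c < d < n)%N ->
  red (\sum_(i <- woven_cycle c) \sum_(j <- woven_cycle d)
    x i (next (woven_cycle c) i) j (next (woven_cycle d) j))
  = (be - ga) *~ (k.-1.*2)%:Z.
Proof.
move=> cdn; have [cn dn] : (c < n)%N /\ (d < n)%N by lia.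
have lowhigh e a b : (e < n)%N -> (a < k)%N -> (b < k)%N -> low e a != high e b.
  move=> en ak bk; have top : ((k + b) * n + e < k.*2 * n)%N.
    by have : ((k + b).+1 * n <= k.*2 * n)%N; [apply: leq_mul => //|]; lia.
  have sep : (a * n + e < (k + b) * n + e)%N.
    by have := leq_mul (leq_trans ak (leq_addr b k)) (leqnn n); lia.
  by apply/eqP => /(y_inj (ltn_trans sep top) top) h; rewrite h ltnn in sep.
have rev_r i j p q : p != q -> x i j q p = - x i j p q.
  by move=> pq; rewrite x_sym x_rev // x_sym.
rewrite (sum_woven (fun i i' => \sum_(j <- woven_cycle d)
  x i i' j (next (woven_cycle d) j)) cn).
rewrite -sum_agree_diff // raddf_sum mulrz_sumr; apply: eq_bigr => i _.
rewrite !(sum_woven (x _ _) dn) -big_split raddf_sum mulrz_sumr /=.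
apply: eq_bigr => j _.
have [ik jk] := (ltn_ord i, ltn_ord j).
have [ik' jk'] : (i.+1 %% k < k)%N /\ (j.+1 %% k < k)%N by rewrite !ltn_mod; lia.
rewrite !(x_rev _ _ (lowhigh _ _ _ cn ik' ik)).
rewrite !(rev_r _ _ _ _ (lowhigh _ _ _ dn jk' jk)) opprK.
rewrite !raddfD !raddfN /= !woven_strands //.
move: (_ *~ agree i i j j) => p1; move: (_ *~ agree _ i j j) => p2.
move: (_ *~ agree i i _ j) => p3; move: (_ *~ agree _ i _ j) => p4.
ring.
Qed.

End Woven.

(** * Linked cycles in a homogeneous set *)

Section LinkedCycles.
Variables (r : nat) (x : 'I_r -> 'I_r -> 'I_r -> 'I_r -> int).
Hypothesis x_sym : forall i j k l, x k l i j = x i j k l.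
Hypothesis x_rev : forall i j k l, i != j -> x j i k l = - x i j k l.
Hypothesis x_parity : exists (lt : rel 'I_r) (E : 'I_r -> 'I_r -> 'I_r -> int),
  (forall p q, p != q -> lt p q = ~~ lt q p) /\
  forall i j k l, uniq [:: i; j; k; l] -> exists K,
    x i j k l = E j k l - E i k l
      + ((lt l j)%:Z - (lt l i)%:Z - E l i j)
      - ((lt k j)%:Z - (lt k i)%:Z - E k i j) + 2 * K.

(** The color of a quadruple for Ramsey's theorem; sequences of other lengths get a dummy value. *)
Definition residues (M : nat) (t : seq 'I_r) : 'Z_M * 'Z_M * 'Z_M :=
  if t is [:: a; b; c; d]
  then ((x a b c d)%:~R, (x a c b d)%:~R, (x a d b c)%:~R) else (0, 0, 0).

(** As [k - 1 = 2 ^ l], the double sum is [2 ^ l.+1] times an odd number modulo [2 ^ l.+2]. The 6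
    additional entries provide the vertices for [homogeneous_parity] when [n] is small. *)
Lemma linked_cycles (n l : nat) (P : seq 'I_r) al be ga :
  let k := (2 ^ l).+1 in
  uniq P -> size P = (k.*2 * n + 6)%N ->
  (forall t, subseq t P -> size t = 4%N -> residues (2 ^ l.+2) t = (al, be, ga)) ->
  exists Q : 'I_n -> seq 'I_r,
    [/\ forall i, oriented_cycle (@complete_graph r) (Q i),
        forall i j, i != j -> [disjoint Q i & Q j] &
        forall i j, i != j -> 2 ^+ l.+1 <=
          `|\sum_(a <- Q i) \sum_(b <- Q j) x a (next (Q i) a) b (next (Q j) b)|].
Proof.
move=> k uP sP homog; have k1 : (1 < k)%N by rewrite ltnS expn_gt0.
set M := (2 ^ l.+2)%N in homog; have M1 : (1 < M)%N by rewrite (ltn_exp2l 0).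
have [x0 _] : exists x0, x0 \in P.
  by case: (P) sP => [|x0 P' _]; [rewrite addnS | exists x0; rewrite mem_head].
pose y := nth x0 P.
have y_inj : {in gtn (size P) &, injective y}.
  by move=> a b aP bP /eqP; rewrite nth_uniq // => /eqP.
have hom a b c d : (a < b < c)%N -> (c < d < size P)%N ->
    residues M [:: y a; y b; y c; y d] = (al, be, ga).
  move=> abc cd; apply: homog => //.
  by apply: (@subseq_nth _ x0 P [:: a; b; c; d]); rewrite /=; lia.
have hom6 a b c d : (a < b < c)%N -> (c < d < 6)%N ->
    residues M [:: y a; y b; y c; y d] = (al, be, ga).
  by move=> abc cd; apply: hom => //; lia.
(* Integer representatives of the residues; as [M] is even, the residues determine their
   parities. *)
pose al' := x (y 0) (y 1) (y 2) (y 3); pose be' := x (y 0) (y 2) (y 1) (y 3).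
pose ga' := x (y 0) (y 3) (y 1) (y 2).
have [alE beE gaE] : [/\ al'%:~R = al, be'%:~R = be & ga'%:~R = ga].
  by have [-> -> ->] := hom6 0 1 2 3 erefl erefl.
have [e eE] : exists e, be' - ga' = 2 * e + 1.
  apply: (homogeneous_parity x_parity (y := y) (al := al')).
    by move=> a b a6 b6; apply: y_inj; rewrite sP; apply: leq_trans (leq_addl _ _).
  have even p q : p%:~R = q%:~R :> 'Z_M -> exists s, p = q + 2 * s.
    move=> /(intr_Zp_inj M1) [s ->]; exists (s * (2 ^ l.+1)%N%:Z).
    by rewrite /M expnS PoszM; ring.
  move=> a b c d abc cd; have [ea eb eg] := hom6 a b c d abc cd.
  have [q1 e1] : exists s, x (y a) (y b) (y c) (y d) = al' + 2 * s.
    by apply: even; rewrite ea alE.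
  have [q2 e2] : exists s, x (y a) (y c) (y b) (y d) = be' + 2 * s.
    by apply: even; rewrite eb beE.
  have [q3 e3] : exists s, x (y a) (y d) (y b) (y c) = ga' + 2 * s.
    by apply: even; rewrite eg gaE.
  by exists q1, q2, q3.
have sub : (k.*2 * n <= size P)%N by rewrite sP leq_addr.
have y_inj' : {in gtn (k.*2 * n)%N &, injective y}.
  by move=> a b ha hb; apply: y_inj; apply: leq_trans sub.
pose Q (i : 'I_n) := woven_cycle n k y i.
have sumQ (i j : 'I_n) : (i < j)%N -> 2 ^+ l.+1 <=
    `|\sum_(a <- Q i) \sum_(b <- Q j) x a (next (Q i) a) b (next (Q j) b)|.
  move=> ij; set S := \sum_(a <- _) _.
  have [q qE] : exists q, S = (be' - ga') * (k.-1.*2)%:Z + q * M%:Z.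
    apply: (intr_Zp_inj M1); rewrite intrM mulrzr intrB beE gaE.
    have yb a b c d : (a < b < c)%N -> (c < d < k.*2 * n)%N ->
        (x (y a) (y c) (y b) (y d))%:~R = be :> 'Z_M.
      by move=> abc cd; have [] : residues M [:: y a; y b; y c; y d] = (al, be, ga)
        by apply: hom => //; lia.
    have yg a b c d : (a < b < c)%N -> (c < d < k.*2 * n)%N ->
        (x (y a) (y d) (y b) (y c))%:~R = ga :> 'Z_M.
      by move=> abc cd; have [] : residues M [:: y a; y b; y c; y d] = (al, be, ga)
        by apply: hom => //; lia.
    apply: (sum_woven_pair x_sym x_rev y_inj' k1 yb yg (red := intmul 1)).
    by rewrite ij ltn_ord.
  have -> : S = 2 ^+ l.+1 * (2 * e + 1) + q * 2 ^+ l.+2.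
    have p2 m : (2 ^ m)%N%:Z = 2 ^+ m by rewrite -natrX natz.
    by rewrite qE eE /M p2 /= -muln2 -expnSr p2; ring.
  exact: odd_multiple_norm (erefl _).
exists Q; split=> [i|i j ij|i j ij].
- have uQ : uniq (Q i) by apply: woven_uniq.
  have sQ : (2 < size (Q i))%N by rewrite size_map size_iota; lia.
  by split=> //; apply/andP; split=> //; apply: uniq_cycle_neq => //; apply: ltnW.
- exact: (woven_disjoint y_inj').
have [lt|gt|/val_inj eq] := ltngtP i j; first exact: sumQ.
  rewrite exchange_big /=; under eq_bigr do under eq_bigr do rewrite x_sym.
  exact: sumQ.
by rewrite eq eqxx in ij.
Qed.

End LinkedCycles.

Theorem theorem1 (R : realType) (n lambda : nat) :
  exists r : nat,
    forall f : pl_embedding R (@complete_graph r),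
    exists Q : 'I_n -> seq 'I_r,
      [/\ forall i, oriented_cycle (@complete_graph r) (Q i),
          forall i j, i != j -> [disjoint Q i & Q j] &
          forall i j, i != j ->
            lambda%:R <=
              `|linking_number (cycle_polygon f (Q i)) (cycle_polygon f (Q j))|].
Proof.
pose M := (2 ^ lambda.+2)%N.
have [r ram] := ramsey ('Z_M * 'Z_M * 'Z_M)%type 4 ((2 ^ lambda).+1.*2 * n + 6).
exists r => f.
have [v offv] := off_spans_exists (differences (arc_points f)).
pose x := arc_crossings f v.
have [|P [[[al be] ga] [sub sP homog]]] :=
  ram _ (residues x M) (enum 'I_r); first by rewrite size_enum_ord.
have uP : uniq P := subseq_uniq sub (enum_uniq _).
have [Q [cQ dQ xQ]] := linked_cycles (arc_crossings_sym f v) (arc_crossings_rev f v)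
  (arc_crossings_parity offv) uP sP homog.
exists Q; split=> // i j ij.
rewrite (linking_number_arcs offv (cQ i) (cQ j) (dQ i j ij)).
have := xQ i j ij; move: (\sum_(a <- _) _) => S hS.
rewrite normrM [`|2^-1|]ger0_norm ?invr_ge0 // ler_pdivlMr // -intr_norm.
(* [S] is twice the linking number, and [lambda < 2 ^ lambda]. *)
apply: le_trans (_ : (2 ^+ lambda.+1)%:~R <= _); last by rewrite ler_int.
rewrite exprSr intrM ler_pM2r // rmorphXn /= -natrX ler_nat.
exact/ltnW/ltn_expl.
Qed.
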